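(* Let $G=(J,\Sigma_J,\nu,E)$ be a bipartite graphing with Borel bipartition $J=S\cup T$, and let $\eta$ be its edge measure. Then $$\sup\{\eta(M)\mid M\text{ is a measurable matching in }G\}=\min_{Z\in\Sigma_E}\{\nu(\partial_S(Z))+\nu(\partial_T(E\setminus Z))\}.$$ Equivalently, $$\sup\{\eta(M)\mid M\text{ is a measurable matching in }G\}=\nu(S)-\max_{X\in\Sigma_S}\{\nu(X)-\nu(N_G(X))\}.$$ (In particular, the minimum and the maximum are attained.)
   Context: A standard measure space is a standard Borel space with a finite atomless measure. Let $(J,\Sigma_J,\nu)$ be a standard measure space. A graphing $G=(J,\Sigma_J,\nu,E)$ is a (simple, undirected) graph on vertex set $J$ whose edge relation $\{(x,y)\in J\times J\mid\{x,y\}\in E\}$ is Borel, with bounded degrees, such that for all Borel $A,B\subseteq J$, $$\int_A\deg(B,x)\,d\nu(x)=\int_B\deg(A,y)\,d\nu(y),$$ where $\deg(X,x)$ is the number of neighbours of $x$ in $X$. $\Sigma_E$ is the Borel $\sigma$-algebra of the unoriented edge space $E$. For $F\in\Sigma_E$, $\deg_F(x)$ is the number of edges of $F$ incident to $x$, and the edge measure is $\eta(F)=\frac12\int_J\deg_F(x)\,d\nu(x)$. $G$ is bipartite with Borel bipartition $J=S\cup T$ if $S,T$ are disjoint Borel sets with union $J$ and every edge has one endpoint in $S$ and the other in $T$. $\Sigma_S$ is the induced Borel $\sigma$-algebra on $S$. A measurable matching is a Borel set $N\subseteq E$ such that every vertex is incident to at most one edge of $N$ (equivalently, modulo null sets of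 edges, $\deg_N(x)\le1$ for $\nu$-almost every $x$). For $Z\in\Sigma_E$, $\partial_S(Z)=\{s\in S\mid\deg_Z(s)>0\}$ and $\partial_T(Z)=\{t\in T\mid\deg_Z(t)>0\}$. For $X\in\Sigma_S$, $N_G(X)$ is the set of vertices of $T$ adjacent to a vertex of $X$. All these sets are Borel. Measurable sets are identified modulo null sets. *)

(* Defs.v *)
From HB Require Import structures.
From mathcomp Require Import all_boot all_order all_algebra.
From mathcomp Require Import all_classical all_reals all_analysis.

Set Implicit Arguments.
Unset Strict Implicit.
Unset Printing Implicit Defensive.

Import Order.TTheory GRing.Theory Num.Theory.

Local Open Scope classical_set_scope.
Local Open Scope ring_scope.
Local Open Scope ereal_scope.

(* Polish = separable, and topologized by a complete metric; [hausdorff_space]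
   turns the library's complete pseudometric into a metric. *)
Definition polish (R : realType) (X : completePseudoMetricType R) : Prop :=
  hausdorff_space X /\ exists2 D : set X, countable D & dense D.

Definition standard_borel (R : realType) d (J : measurableType d) : Prop :=
  exists (X : completePseudoMetricType R) (f : J -> X),
    [/\ polish X, bijective f &
        forall B : set X, <<s [set U : set X | open U] >> B
                          <-> d.-measurable (f @^-1` B)].

Definition is_atom (R : realType) d (J : measurableType d)
    (nu : set J -> \bar R) (A : set J) : Prop :=
  [/\ d.-measurable A, 0 < nu A &
      forall B, d.-measurable B -> B `<=` A -> nu B = 0 \/ nu B = nu A].

Definition atomless (R : realType) d (J : measurableType d)
    (nu : set J -> \bar R) : Prop :=
  forall A, ~ is_atom nu A.

(* Finiteness of the measure is carried by its type. *)
Definition standard_measure_space (R : realType) d (J : measurableType d)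
    (nu : {finite_measure set J -> \bar R}) : Prop :=
  standard_borel R J /\ atomless nu.

(* A set of unoriented edges F is encoded by its edge relation
   {(x, y) | {x, y} \in F}, a symmetric subset of J * J.  Accordingly, the
   Borel sets of unoriented edges are the symmetric Borel subsets of J * J. *)

(* Number of F-neighbours of x in X, that is deg(X, x) for F the edge set. *)
Definition deg_in (R : realType) d (J : measurableType d)
    (F : set (J * J)) (X : set J) (x : J) : \bar R :=
  counting (xsection F x `&` X).

(* Number of edges of F incident to x. *)
Definition deg (R : realType) d (J : measurableType d)
    (F : set (J * J)) (x : J) : \bar R :=
  counting (xsection F x).

Definition symmetric_rel d (J : measurableType d) (F : set (J * J)) : Prop :=
  forall x y, F (x, y) -> F (y, x).

Record graphing (R : realType) d (J : measurableType d)
    (nu : {finite_measure set J -> \bar R}) (E : set (J * J)) : Prop := {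
  graphing_irreflexive : forall x, ~ E (x, x);
  graphing_symmetric : symmetric_rel E;
  graphing_measurable : measurable E;
  graphing_bounded_degree :
    exists D : nat, forall x, deg R E x <= D%:R%:E;
  graphing_measure_preserving : forall A B : set J,
    d.-measurable A -> d.-measurable B ->
    \int[nu]_(x in A) deg_in R E B x = \int[nu]_(y in B) deg_in R E A y
}.

(* The sigma-algebra Sigma_E of the unoriented edge space. *)
Definition borel_edge_sets d (J : measurableType d) (E : set (J * J)) :
    set (set (J * J)) :=
  [set F | [/\ F `<=` E, symmetric_rel F & measurable F]].

Definition edge_measure (R : realType) d (J : measurableType d)
    (nu : {finite_measure set J -> \bar R}) (F : set (J * J)) : \bar R :=
  2^-1%:E * \int[nu]_x deg R F x.

Definition measurable_matchings (R : realType) d (J : measurableType d)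
    (E : set (J * J)) : set (set (J * J)) :=
  [set N | borel_edge_sets E N /\ forall x, deg R N x <= 1].

Record bipartition d (J : measurableType d)
    (E : set (J * J)) (S T : set J) : Prop := {
  bipartition_measurableS : d.-measurable S;
  bipartition_measurableT : d.-measurable T;
  bipartition_disjoint : S `&` T = set0;
  bipartition_cover : S `|` T = [set: J];
  bipartition_edge :
    forall x y, E (x, y) -> (S x /\ T y) \/ (T x /\ S y)
}.

(* \partial_A(Z); it is Borel for Borel A and Z, since Z has finite degrees. *)
Definition boundary (R : realType) d (J : measurableType d)
    (A : set J) (Z : set (J * J)) : set J :=
  [set x | A x /\ 0 < deg R Z x].

(* N_G(X), again a Borel set for Borel X. *)
Definition neighbourhood d (J : measurableType d)
    (E : set (J * J)) (T X : set J) : set J :=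
  [set t | T t /\ exists2 s, X s & E (s, t)].

Definition is_min (R : realType) (A : set (\bar R)) (m : \bar R) : Prop :=
  A m /\ lbound A m.

Definition is_max (R : realType) (A : set (\bar R)) (m : \bar R) : Prop :=
  A m /\ ubound A m.

(* Main.v *)
Require Import Defs.
From HB Require Import structures.
From mathcomp Require Import all_boot all_order all_algebra.
From mathcomp Require Import all_classical all_reals all_analysis.
From mathcomp Require Import measurable_realfun zify lra.
From mathcomp Require finmap.

Set Implicit Arguments.
Unset Strict Implicit.
Unset Printing Implicit Defensive.

Import Order.TTheory GRing.Theory Num.Theory.
Import numFieldNormedType.Exports.

Local Open Scope classical_set_scope.

(** Every matching is at most the measure of an edge cover: the edges of a
    matching lying in Z are counted by their ends in S, the others by their ends
    in T ([weak_duality]).  A Borel set X of S gives the cover Z formed by the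
    edges that meet S \ X, of measure at most nu(S) - (nu(X) - nu(N(X)))
    ([edge_cover_of_set]).  So everything follows once some X maximizes
    nu(X) - nu(N(X)) and matchings come arbitrarily close to the bound that this
    X provides.

    The maximum is attained because X |-> nu(X) - nu(N(X)) is supermodular: the
    defects of a fast maximizing sequence add up under unions, so the limit
    superior of the sequence is optimal ([max_deficiency]).

    Near-optimal matchings come from an auction ([auction_matching]).  Every
    vertex of T carries an integer price, at first 0 and capped by K.  An
    unmatched s whose cheapest neighbour t costs less than K takes t, evicting
    its holder, and the price of t goes up by 1.  The edge set is a countable
    union of Borel partial injections; serving these one at a time, each
    infinitely often, makes simultaneous bids free of conflict.  Prices are
    monotone and bounded, so every vertex of T is eventually stable and the run
    converges pointwise to a Borel matching M with prices p such that: a vertex of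
    positive price is matched; the partner of s costs at most 1 more than any
    neighbour of s; all neighbours of an unmatched s cost K.  Let X_i be the set
    of s all of whose neighbours cost at least i.  The partners of N(X_(i+1)) lie
    in X_i, and so do the unmatched vertices U of S, whence
    nu(N(X_(i+1))) + nu(U) <= nu(X_i).  The X_i decrease, so for some i < K
    the step from X_i to X_(i+1) loses at most nu(S)/K, and
    nu(U) <= nu(X_(i+1)) - nu(N(X_(i+1))) + nu(S)/K.

    Two facts about bounded degree Borel graphs support this.  First, the sets met
    above must be Borel, although they are projections.  The edge set of such a
    graph is covered by countably many graphs of Borel maps
    ([standard_borel_uniformization]), which is derived here from the separation
    of disjoint analytic sets ([lusin_separation]).  Second, the measure
    preservation hypothesis speaks of rectangles only; a monotone class argument
    extends it to all Borel sets of edges ([mass_transport]), so that the two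
    sides of a Borel matching have the same measure ([measure_dom_cod]). *)

(** * Analytic subsets of sequence spaces *)

Definition agree (A : Type) n (p q : nat -> A) := forall i, (i < n)%N -> p i = q i.

(** The closed sets of the product topology on [nat -> A], for discrete [A]. *)
Definition seq_closed (A : Type) (C : set (nat -> A)) :=
  forall p, ~ C p -> exists n, forall q, agree n p q -> ~ C q.

Definition pair_seq (A B : Type) (p : nat -> A) (q : nat -> B) : nat -> A * B :=
  fun i => (p i, q i).

(** A projection of a closed set along the Baire space; coordinates are paired
    so that both factors are read at the same rate. *)
Definition analytic (A : Type) (F : set (nat -> A)) :=
  exists2 C : set (nat -> A * nat), seq_closed C &
    forall p, F p <-> exists s, C (pair_seq p s).

Lemma agreeW (A : Type) m n (p q : nat -> A) :
  (m <= n)%N -> agree n p q -> agree m p q.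
Proof. by move=> mn pq i im; apply: pq; exact: leq_trans mn. Qed.

(** The hypothesis on [f] is uniform continuity; it holds for all the
    reindexings of coordinates used below. *)
Lemma seq_closed_preimage (A B : Type) (f : (nat -> A) -> nat -> B) (C : set (nat -> B)) :
  (forall n, exists m, forall p q, agree m p q -> agree n (f p) (f q)) ->
  seq_closed C -> seq_closed (f @^-1` C).
Proof.
move=> fc clC p /= /clC[n Cn]; have [m fm] := fc n.
by exists m => q pq; apply/Cn/fm.
Qed.

Lemma seq_closed_bigcap (A I : Type) (C : I -> set (nat -> A)) :
  (forall i, seq_closed (C i)) -> seq_closed (\bigcap_i C i).
Proof.
move=> clC p /existsNP[i /not_implyP[_ Cip]].
by have [n Cn] := clC i p Cip; exists n => q /Cn; apply: contra_not; exact.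
Qed.

Lemma analytic_coordinate (A : Type) k (P : set A) :
  analytic [set p : nat -> A | P (p k)].
Proof.
exists [set q : nat -> A * nat | P (q k).1].
  by move=> p Pp; exists k.+1 => q pq; rewrite /= -(pq k).
by move=> p; split => [?|[]//]; exists (fun=> 0%N).
Qed.

(** The first entry of the witness announces which [F i] it is a witness for. *)
Lemma analytic_bigcup (A : Type) (I : countType) (F : I -> set (nat -> A)) :
  (forall i, analytic (F i)) -> analytic (\bigcup_i F i).
Proof.
move=> /(_ _)/cid2-/all_sig2[C clC CF].
exists [set q : nat -> A * nat | exists2 i, unpickle (q 0%N).2 = Some i &
          C i (fun k => ((q k).1, (q k.+1).2))].
  move=> p /= pC; case E : (unpickle (p 0%N).2) => [i|]; last first.
    by exists 1%N => q pq [j]; rewrite -pq// E.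
  have : ~ C i (fun k => ((p k).1, (p k.+1).2)) by move=> Cp; apply: pC; exists i.
  move=> /clC[n Cn]; exists n.+1 => q pq [j]; rewrite -pq// E => -[<-].
  by apply: Cn => k kn; rewrite !pq// ltnS// ltnW.
move=> p; split => [[i _ /CF[s Cs]]|[s [i si Cs]]]; last first.
  by exists i => //; apply/CF; exists (fun k => s k.+1).
by exists (fun k => if k is k'.+1 then s k' else pickle i); exists i => //=; exact: pickleK.
Qed.

(** One witness codes a witness for every [F i], spread along a bijection of
    [nat * nat] with [nat]. *)
Lemma analytic_bigcap (A : Type) (F : nat -> set (nat -> A)) :
  (forall i, analytic (F i)) -> analytic (\bigcap_i F i).
Proof.
move=> /(_ _)/cid2-/all_sig2[C clC CF].
exists (\bigcap_m [set q : nat -> A * nat |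
          C m (fun i => ((q i).1, (q (pickle (m, i))).2))]).
  apply: seq_closed_bigcap => m; apply: seq_closed_preimage (clC m) => n.
  exists (\max_(i < n) (maxn i (pickle (m, nat_of_ord i))).+1)%N => p q pq i im.
  have := @leq_bigmax _ (fun i : 'I_n => (maxn i (pickle (m, nat_of_ord i))).+1) (Ordinal im).
  move=> /= le_max.
  rewrite (pq i) ?(pq (pickle (m, i)))//; apply: leq_trans le_max; rewrite ltnS.
    exact: leq_maxr.
  exact: leq_maxl.
move=> p; split => [FP|[s Cs] m _]; last first.
  by apply/CF; exists (fun i => s (pickle (m, i))); exact: (Cs m).
have /choice[s Cs] : forall m, exists s, C m (pair_seq p s) by move=> m; apply/CF/FP.
exists (fun k => if unpickle k is Some (m, i) then s m i else 0%N) => m _ /=.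
rewrite (_ : (fun i => _) = pair_seq p (s m))//.
by apply/funext => i; rewrite pickleK.
Qed.

Lemma analytic_setI (A : Type) (F G : set (nat -> A)) :
  analytic F -> analytic G -> analytic (F `&` G).
Proof.
move=> aF aG.
have -> : F `&` G = \bigcap_i (if i is 0%N then F else G).
  by apply/seteqP; split => [p [Fp Gp] [|i]//|p FG]; split; [apply: (FG 0%N)|apply: (FG 1%N)].
by apply: analytic_bigcap; case.
Qed.

Lemma analytic_setT (A : Type) : analytic [set: nat -> A].
Proof. exact: (@analytic_coordinate A 0 setT). Qed.

Lemma analytic_set0 (A : Type) : analytic (@set0 (nat -> A)).
Proof. exact: (@analytic_coordinate A 0 set0). Qed.

Lemma analytic_proj (F : set (nat -> nat * nat)) :
  analytic F -> analytic [set x | exists y, F (pair_seq x y)].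
Proof.
move=> [C clC CF].
pose decode k : nat * nat := odflt (0, 0)%N (unpickle k).
exists [set q : nat -> nat * nat | C (fun i => ((q i).1, (decode (q i).2).1,
  (decode (q i).2).2))].
  apply: seq_closed_preimage clC => n; exists n => p q pq i im.
  by rewrite !pq.
move=> x; split => [[y /CF[s Cs]]|[s Cs]].
  exists (fun i => pickle (y i, s i)); rewrite /=.
  rewrite (_ : (fun i => _) = pair_seq (pair_seq x y) s)//.
  by apply/funext => i; rewrite /pair_seq /= /decode pickleK.
by exists (fun i => (decode (s i)).1); apply/CF; exists (fun i => (decode (s i)).2).
Qed.

(** These sets form a sigma-algebra, which is why Borel sets are analytic;
    analytic sets alone are not stable under complement. *)
Definition bianalytic (A : Type) : set (set (nat -> A)) :=
  [set F | analytic F /\ analytic (~` F)].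

Lemma sigma_algebra_bianalytic (A : Type) : sigma_algebra setT (@bianalytic A).
Proof.
split.
- by split; rewrite ?setC0; [exact: analytic_set0|exact: analytic_setT].
- by move=> F [aF aCF]; rewrite setTD; split; rewrite ?setCK.
- move=> F aF; split; first by apply: analytic_bigcup => i; exact: (aF i).1.
  by rewrite setC_bigcup; apply: analytic_bigcap => i; exact: (aF i).2.
Qed.

Definition coordinate_sets : set (set (nat -> nat)) :=
  [set B | exists k, exists i, B = [set x | x k = i]].

(** The Baire space with its Borel sigma-algebra. *)
Definition baire := g_sigma_algebraType coordinate_sets.
HB.instance Definition _ := Measurable.on baire.

Lemma measurable_coordinate k i : measurable [set x : baire | x k = i].
Proof. by apply: sub_sigma_algebra; exists k, i. Qed.

Lemma measurable_fun_baire d (T : measurableType d) (f : T -> baire) :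
  (forall k i, measurable [set t | f t k = i]) -> measurable_fun setT f.
Proof.
move=> mf; apply: (@measurability _ _ T baire setT f coordinate_sets) => //.
by move=> _ [B [k [i ->]] <-]; rewrite setTI; exact: mf.
Qed.

Lemma analytic_measurable (F : set (baire * baire)) : measurable F ->
  analytic [set p : nat -> nat * nat | F (fst \o p, snd \o p)].
Proof.
pose unzip (p : nat -> nat * nat) : baire * baire := (fst \o p, snd \o p).
suff H : @measurable _ (baire * baire)%type `<=`
    image_set_system setT unzip (@bianalytic (nat * nat)%type).
  by move=> /H /= [+ _]; rewrite setTI.
rewrite measurable_prod_measurableType; apply: smallest_sub.
  by apply: sigma_algebra_image; exact: sigma_algebra_bianalytic.
have saf (g : nat * nat -> nat) : @measurable _ baire `<=`
    image_set_system setT (fun p : nat -> nat * nat => g \o p) (@bianalytic (nat * nat)%type).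
  apply: smallest_sub.
    by apply: sigma_algebra_image; exact: sigma_algebra_bianalytic.
  move=> _ [k [i ->]]; rewrite /image_set_system /= setTI.
  split; first exact: (analytic_coordinate k [set a | g a = i]).
  exact: (analytic_coordinate k [set a | g a <> i]).
move=> _ [B mB] [B' mB'] <-.
have [[aB aCB] [aB' aCB']] := (saf fst B mB, saf snd B' mB').
rewrite /image_set_system /= !setTI in aB aCB aB' aCB' *.
split; first exact: analytic_setI aB aB'.
rewrite (_ : ~` _ = \bigcup_b (if b then ~` ((fun p => fst \o p) @^-1` B)
   else ~` ((fun p => snd \o p) @^-1` B'))).
  by apply: analytic_bigcup; case.
apply/seteqP; split => p /=.
  by move=> /not_andP[?|?]; [exists true|exists false].
by case=> -[] _ + [].
Qed.

Lemma analytic_fst_proj (F : set (baire * baire)) : measurable F ->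
  analytic [set x | exists y, F (x, y)].
Proof. by move=> /analytic_measurable/analytic_proj. Qed.

(** * Separation of analytic sets by Borel sets *)
Lemma countable_bigcapT_measurable d (T : measurableType d) (I : countType) (F : I -> set T) :
  (forall i, measurable (F i)) -> measurable (\bigcap_i F i).
Proof.
move=> mF; rewrite -[X in measurable X]setCK setC_bigcap; apply: measurableC.
by apply: countable_bigcupT_measurable => [|i]; [exact: countableP|exact: measurableC].
Qed.

Section lusin_separation.

Definition separable (F G : set baire) :=
  exists2 W : set baire, measurable W & F `<=` W /\ W `&` G = set0.

Lemma separable_bigcup (I K : countType) (F : I -> set baire) (G : K -> set baire) :
  (forall i k, separable (F i) (G k)) -> separable (\bigcup_i F i) (\bigcup_k G k).
Proof.
move=> sFG.
have /choice[W WP] : forall ik : I * K, exists W : set baire,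
    measurable W /\ (F ik.1 `<=` W /\ W `&` G ik.2 = set0).
  by move=> [i k]; have [W] := sFG i k; exists W.
exists (\bigcup_i \bigcap_k W (i, k)).
  apply: countable_bigcupT_measurable => [|i]; first exact: countableP.
  by apply: countable_bigcapT_measurable => k; exact: (WP (i, k)).1.
split.
  by move=> x [i _ Fx]; exists i => // k _; exact: (WP (i, k)).2.1.
rewrite -subset0 => x [[i _ Wx] [k _ Gx]].
by rewrite -(WP (i, k)).2.2; split; [exact: Wx|].
Qed.

(** The part of the projection of [C] whose witnesses extend the first [n]
    entries of [p].  Those [n] entries fix [n] coordinates of the point as well
    as [n] entries of the witness. *)
Let piece (C : set (nat -> nat * nat)) n p : set baire :=
  [set x | exists2 s, C (pair_seq x s) & agree n p (pair_seq x s)].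

Let extend n (p : nat -> nat * nat) a := fun i => if (i < n)%N then p i else a.

Let piece_split C n p : piece C n p = \bigcup_a piece C n.+1 (extend n p a).
Proof.
apply/seteqP; split => x.
  move=> [s Cs ps]; exists (x n, s n) => //; exists s => // i.
  rewrite ltnS leq_eqVlt /extend => /orP[/eqP->|im]; first by rewrite ltnn.
  by rewrite im ps.
move=> [a _ [s Cs ps]]; exists s => // i im.
by rewrite -ps 1?ltnW// /extend im.
Qed.

Let piece0 C p (F : set baire) :
  (forall x, F x <-> exists s, C (pair_seq x s)) -> piece C 0 p = F.
Proof.
by move=> CF; apply/seteqP; split => [x [s Cs _]|x /CF[s Cs]]; [apply/CF|]; exists s.
Qed.

(** If [F] and [G] are inseparable, then since separation passes to countable
    unions, some pieces of [F] and [G] one level deeper are inseparable too.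
    Following inseparable pieces yields branches [p] and [q] which, [C] and [D]
    being closed, are witnessed points of [F] and [G].  These points differ at a
    coordinate [k], and the value there separates the pieces of level [k.+1]. *)
Lemma lusin_separation (F G : set baire) :
  analytic F -> analytic G -> F `&` G = set0 -> separable F G.
Proof.
move=> [C clC CF] [D clD DG] FG0; apply: contrapT => nsep.
pose insep n (pq : (nat -> nat * nat) * (nat -> nat * nat)) :=
  ~ separable (piece C n pq.1) (piece D n pq.2).
have /choice[next nextP] : forall npq : nat * ((nat -> nat * nat) * (nat -> nat * nat)),
    exists pq, insep npq.1 npq.2 ->
     [/\ agree npq.1 npq.2.1 pq.1, agree npq.1 npq.2.2 pq.2 & insep npq.1.+1 pq].
  move=> [n [p q]] /=; have [ins|] := pselect (insep n (p, q)); last by exists (p, q).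
  have : exists ab, insep n.+1 (extend n p ab.1, extend n q ab.2).
    apply: contrapT => /forallNP nins; apply: ins => /=.
    rewrite (piece_split C) (piece_split D); apply: separable_bigcup => a b.
    by have /contrapT := nins (a, b).
  move=> [[a b] ins']; exists (extend n p a, extend n q b) => _.
  by split => // i im; rewrite /= /extend im.
pose u := fix u n := if n is n'.+1 then next (n', u n')
  else ((fun=> (0, 0)%N), (fun=> (0, 0)%N)).
have insu n : insep n (u n).
  elim: n => [|n IH]; last by have [] := nextP (n, u n) IH.
  by rewrite /insep (piece0 _ CF) (piece0 _ DG).
have stab1 n m : (n <= m)%N -> agree n (u n).1 (u m).1.
  elim: m => [|m IH]; first by rewrite leqn0 => /eqP ->.
  rewrite leq_eqVlt ltnS => /orP[/eqP->//|nm] i im; rewrite IH//.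
  by have [+ _ _] := nextP (m, u m) (insu m); apply; exact: leq_trans nm.
have stab2 n m : (n <= m)%N -> agree n (u n).2 (u m).2.
  elim: m => [|m IH]; first by rewrite leqn0 => /eqP ->.
  rewrite leq_eqVlt ltnS => /orP[/eqP->//|nm] i im; rewrite IH//.
  by have [_ + _] := nextP (m, u m) (insu m); apply; exact: leq_trans nm.
pose p i := (u i.+1).1 i; pose q i := (u i.+1).2 i.
have up n : agree n (u n).1 p by move=> i im; rewrite /p (stab1 i.+1 n).
have uq n : agree n (u n).2 q by move=> i im; rewrite /q (stab2 i.+1 n).
have pieceF n : piece C n (u n).1 !=set0.
  apply: contrapT => F0; apply: (insu n); exists set0 => //; split; last by rewrite set0I.
  by move=> x Fx; apply: F0; exists x.
have pieceG n : piece D n (u n).2 !=set0.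
  apply: contrapT => G0; apply: (insu n); exists setT => //; split => //.
  by rewrite -subset0 => x [_ Gx]; apply: G0; exists x.
have Cp : C p.
  apply: contrapT => /clC[n]; have [x [s Cs ps]] := pieceF n.
  by move=> /(_ (pair_seq x s)); apply => // i im; rewrite -(up n i im) ps.
have Dq : D q.
  apply: contrapT => /clD[n]; have [x [s Cs ps]] := pieceG n.
  by move=> /(_ (pair_seq x s)); apply => // i im; rewrite -(uq n i im) ps.
have Fp : F (fst \o p).
  apply/CF; exists (snd \o p); rewrite (_ : pair_seq _ _ = p)//.
  by apply/funext => i; rewrite /pair_seq /=; case: (p i).
have Gq : G (fst \o q).
  apply/DG; exists (snd \o q); rewrite (_ : pair_seq _ _ = q)//.
  by apply/funext => i; rewrite /pair_seq /=; case: (q i).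
have [k pqk] : exists k, (p k).1 <> (q k).1.
  apply/existsNP => pq; suff : set0 (fst \o p) by [].
  by rewrite -FG0; split => //; rewrite (_ : _ \o p = fst \o q)//; exact/funext.
apply: (insu k.+1); exists [set x | x k = (p k).1]; first exact: measurable_coordinate.
split; first by move=> x [s _ /(_ k (ltnSn k)) ps]; rewrite /= /p ps.
rewrite -subset0 => x [/= xp [s _ /(_ k (ltnSn k)) qs]]; apply: pqk.
by rewrite -xp /q qs.
Qed.

End lusin_separation.

(** * Borel uniformization of Borel sets with bounded sections *)
Lemma separation_family (F : nat -> set baire) :
  (forall i, analytic (F i)) -> (forall i j, i <> j -> F i `&` F j = set0) ->
  exists W : nat -> set baire, [/\ forall i, measurable (W i), forall i, F i `<=` W i &
    forall i j, i <> j -> W i `&` F j = set0].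
Proof.
move=> aF dF.
have /choice[W WP] : forall i, exists W : set baire, [/\ measurable W, F i `<=` W &
    W `&` (\bigcup_j (if j == i then set0 else F j)) = set0].
  move=> i; have [|||W mW [FW WF]] := @lusin_separation (F i) (\bigcup_j (if j == i then
    set0 else F j)).
  - exact: aF.
  - by apply: analytic_bigcup => j; case: ifP => // _; exact: analytic_set0.
  - rewrite -subset0 => x [Fi [j _]]; case: eqVneq => // /eqP ji Fj.
    by rewrite -(dF _ _ (nesym ji)).
  by exists W.
exists W; split=> [i|i|i j ij]; [by have [] := WP i|by have [] := WP i|].
have [_ _ WF] := WP i; rewrite -subset0 -WF => x [Wx Fx]; split => //.
by exists j => //; case: eqP => // /esym.
Qed.

(** The points [x] whose unique partner has [k]-th coordinate [i] form, as [i]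
    varies, disjoint analytic sets.  Borel sets separating them read off that
    coordinate in a Borel way, also at the points without a partner. *)
Lemma single_valued_uniformization (E : set (baire * baire)) : measurable E ->
  (forall x y y', E (x, y) -> E (x, y') -> y = y') ->
  exists2 h : baire -> baire, measurable_fun setT h & forall x y, E (x, y) -> y = h x.
Proof.
move=> mE E1.
pose P k i : set baire := [set x | exists2 y, E (x, y) & y k = i].
have aP k i : analytic (P k i).
  rewrite (_ : P k i = [set x | exists y : baire, (E `&` (snd @^-1` [set y :
    baire | y k = i])) (x, y)]).
    apply: analytic_fst_proj; apply: measurableI => //.
    rewrite -[X in measurable X]setTI.
    by apply: measurable_snd => //; exact: measurable_coordinate.
  by apply/seteqP; split => [x [y Exy yk]|x [y [Exy yk]]]; exists y.
have /choice[W WP] : forall k, exists W : nat -> set baire, [/\ forall i, measurable (W i),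
    forall i, P k i `<=` W i & forall i j, i <> j -> W i `&` P k j = set0].
  move=> k; apply: separation_family => // i j ij.
  rewrite -subset0 => x [[y Ey yi] [z Ez zj]]; apply: ij.
  by rewrite -yi -zj (E1 x y z).
have mW k i : measurable (W k i) by have [] := WP k.
pose h (x : baire) : baire := fun k => xget 0%N [set i | W k i x /\ forall j,
  (j < i)%N -> ~ W k j x].
have hP k i x : W k i x -> (forall j, (j < i)%N -> ~ W k j x) -> h x k = i.
  move=> Wi Wj; rewrite /h; case: xgetP => [j _ [Wjx Wlt]|/(_ i)/=]; last by case.
  by case: (ltngtP i j) => [ij|ji|->//]; [case: (Wlt i ij)|case: (Wj j ji)].
exists h.
  apply: measurable_fun_baire => k i.
  rewrite (_ : [set _ | _] = (W k i `&` \bigcap_(j in [set j | j < i]%N) ~` W k j) `|`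
     (if i is 0%N then \bigcap_j ~` W k j else set0)).
    apply: measurableU.
      apply: measurableI => //; apply: bigcap_measurableType => j _.
      exact: measurableC.
    by case: i => // ; apply: bigcap_measurableType => j _; exact: measurableC.
  apply/seteqP; split => x /=.
    rewrite {1}/h; case: xgetP => [j _ /= [Wj Wlt] <-|W0 <-]; first by left.
    right => j _ Wj; have : exists j, W k j x by exists j.
    move=> /asboolP eW.
    have ex : exists j, `[< W k j x >] by exists j; apply/asboolP.
    have := W0 (ex_minn ex); case: ex_minnP => m /asboolP Wm mmin; apply;
      split => // l lm /asboolP /mmin.
    by rewrite leqNgt lm.
  case=> [[Wi Wj]|]; first by apply: hP => // j ji; exact: Wj.
  case: i => // W0; rewrite /h; case: xgetP => // j _ [Wj _].
  by have := W0 j I Wj.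
move=> x y Exy; apply/funext => k; apply/esym.
have [_ PW WP0] := WP k; have Py : P k (y k) x by exists y.
apply: hP; first exact: PW.
by move=> j jy Wj; have := WP0 j (y k); rewrite -subset0 => /(_ _ x); apply => // jE;
  rewrite jE ltnn in jy.
Qed.

Definition cylinder (w : seq nat) : set baire :=
  [set x | forall i, (i < size w)%N -> x i = nth 0%N w i].

Lemma measurable_cylinder w : measurable (cylinder w).
Proof.
rewrite (_ : cylinder w = \bigcap_(i in [set i | i < size w]%N) [set x | x i = nth 0%N w i])//.
by apply: bigcap_measurableType => i _; exact: measurable_coordinate.
Qed.

(** Cylinders isolate a point from finitely many others; there are countably
    many of them, which is what keeps the unions below countable. *)
Lemma cylinder_separation (y : baire) (s : seq baire) : y \notin s ->
  exists2 w, cylinder w y & forall z, z \in s -> ~ cylinder w z.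
Proof.
move=> ys.
have [n nP] : exists n, forall z, z \in s -> ~ agree n y z.
  elim: s ys => [_|z s IH]; first by exists 0%N.
  rewrite inE negb_or => /andP[/eqP yz /IH[n nP]].
  have [k yzk] : exists k, y k <> z k by apply/existsNP => yz'; apply: yz; exact/funext.
  exists (maxn n k.+1) => z'; rewrite inE => /orP[/eqP -> H|/nP H /(agreeW (leq_maxl _ _))//].
  by apply: yzk; apply: H; rewrite leq_max ltnSn orbT.
exists (mkseq y n); first by move=> i; rewrite size_mkseq => im; rewrite nth_mkseq.
move=> z /nP yz cz; apply: yz => i im.
by rewrite cz ?size_mkseq// nth_mkseq.
Qed.

Definition atleast (T : eqType) k (A : set T) :=
  exists s : seq T, [/\ uniq s, size s = k & forall y, y \in s -> A y].

Lemma atleast_setUI (T : eqType) j k (A B : set T) :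
  atleast j (A `&` B) -> atleast k (A `\` B) -> atleast (j + k) A.
Proof.
move=> [s [us <- sA]] [t [ut <- tA]]; exists (s ++ t); split.
- rewrite cat_uniq us ut andbT /=; apply/hasPn => y /tA[_ nBy].
  by apply/negP => /sA[].
- by rewrite size_cat.
- by move=> y; rewrite mem_cat => /orP[/sA[]|/tA[]].
Qed.

(** A section has [k.+1] points when some cylinder holds one of them and [k]
    others lie outside of it: this avoids quantifying over tuples of points. *)
Lemma analytic_atleast k (E : set (baire * baire)) : measurable E ->
  analytic [set x : baire | atleast k [set y : baire | E (x, y)]].
Proof.
elim: k E => [|k IH] E mE.
  rewrite (_ : [set _ | _] = setT); first exact: analytic_setT.
  by apply/seteqP; split => // x _; exists [::].
rewrite (_ : [set _ | _] = \bigcup_w ([set x | exists y, (E `&`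
  (snd @^-1` cylinder w)) (x, y)] `&`
   [set x | atleast k [set y | (E `\` (snd @^-1` cylinder w)) (x, y)]])).
  have mw w : measurable (@snd baire baire @^-1` cylinder w).
    by rewrite -[X in measurable X]setTI; apply: measurable_snd => //;
      exact: measurable_cylinder.
  apply: analytic_bigcup => w; apply: analytic_setI.
    by apply: analytic_fst_proj; apply: measurableI.
  by apply: IH; exact: measurableD.
apply/seteqP; split => x /=.
  move=> [[|y s] [// us [sk] sE]]; move: us => /= /andP[ys us].
  have [w wy ws] := cylinder_separation ys; exists w => //; split.
    by exists y; split => //; apply: sE; rewrite mem_head.
  exists s; split => // z zs; split; last exact: ws.
  by apply: sE; rewrite inE zs orbT.
move=> [w _ [[y [Ey wy]] [s [us sk sE]]]]; exists (y :: s); split => /=.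
- by rewrite us andbT; apply/negP => /sE[_]; exact.
- by rewrite sk.
- by move=> z; rewrite inE => /orP[/eqP ->|/sE[]].
Qed.

(** Induction on the bound.  Over the analytic set of the points [x] with [D]
    partners outside a cylinder [w], the section has at most one point in [w],
    and by separation this persists over a Borel set [W w].  The part of [E] in
    [W w `*` cylinder w] is thus single-valued.  A section with [D.+1] points
    loses all of them when these parts are removed, since each of its points is
    isolated from the other [D] by some cylinder. *)
Lemma bounded_uniformization D (E : set (baire * baire)) : measurable E ->
  (forall x, ~ atleast D.+1 [set y : baire | E (x, y)]) ->
  exists2 h : nat -> baire -> baire, forall j, measurable_fun setT (h j) &
    forall x y, E (x, y) -> exists j, y = h j x.
Proof.
elim: D E => [|D IH] E mE ED.
  exists (fun=> id) => [j|x y Exy]; first exact: measurable_id.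
  by exfalso; apply: (ED x); exists [:: y]; split => // z; rewrite inE => /eqP ->.
have mw w : measurable (@snd baire baire @^-1` cylinder w).
  by rewrite -[X in measurable X]setTI; apply: measurable_snd => //;
    exact: measurable_cylinder.
have /choice[W WP] : forall w, exists W : set baire, [/\ measurable W,
   forall x : baire, atleast D [set y : baire | (E `\` (snd @^-1` cylinder w)) (x, y)] -> W x &
   forall x : baire, W x -> ~ atleast 2 [set y : baire | (E `&`
     (snd @^-1` cylinder w)) (x, y)]].
  move=> w.
  have [|||W mW [FW WG]] := @lusin_separation
     [set x : baire | atleast D [set y : baire | (E `\` (snd @^-1` cylinder w)) (x, y)]]
     [set x : baire | atleast 2 [set y : baire | (E `&` (snd @^-1` cylinder w)) (x, y)]].
  - by apply: analytic_atleast; exact: measurableD.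
  - by apply: analytic_atleast; exact: measurableI.
  - rewrite -subset0 => x [/= H1 H2]; apply: (ED x).
    exact: (@atleast_setUI _ 2 D [set y | E (x, y)] (cylinder w)).
  by exists W; split => // x Wx H; rewrite -[False]/(set0 x) -WG.
have mWw w : measurable (W w `*` cylinder w).
  by apply: measurableX; [have [] := WP w|exact: measurable_cylinder].
have /choice[h hP] : forall w, exists h : baire -> baire, measurable_fun setT h /\
    forall x y, (E `&` (W w `*` cylinder w)) (x, y) -> y = h x.
  move=> w; have [||h mh hE] := @single_valued_uniformization (E `&`
    (W w `*` cylinder w)); last by exists h.
    exact: measurableI.
  move=> x y y' [Ey [/= Wx wy]] [Ey' [/= _ wy']]; apply: contrapT => /eqP yy'.
  have [_ _ /(_ x Wx)] := WP w; apply; exists [:: y; y'].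
  split => //=; first by rewrite inE yy'.
  by move=> z; rewrite !inE => /orP[] /eqP ->.
have [||h' mh' hE'] := IH (E `\` \bigcup_w (W w `*` cylinder w)).
- by apply: measurableD => //; apply: countable_bigcupT_measurable => //; exact: countableP.
- move=> x [[|y s] [// us [sD] sE]]; move: us => /= /andP[ys us].
  have [w wy ws] := cylinder_separation ys.
  have [Exy] := sE y (mem_head _ _); apply; exists w => //; split => //=.
  have [_ H _] := WP w; apply: H; exists s; split => // z zs; split; last exact: ws.
  by have [] := sE z; rewrite // inE zs orbT.
exists (fun j => match unpickle j with Some (inl w) => h w | Some (inr i) => h' i |
  None => id end).
  move=> j; case: (unpickle j) => [[w|i]|].
  - exact: (hP w).1.
  - exact: mh'.
  - exact: measurable_id.
move=> x y Exy.
have [[w _ Wwxy]|nW] := pselect ((\bigcup_w (W w `*` cylinder w)) (x, y)).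
  exists (pickle (inl w : seq nat + nat)%type); rewrite pickleK.
  exact: (hP w).2.
have [|i ->] := hE' x y; first by split.
by exists (pickle (inr i : seq nat + nat)%type); rewrite pickleK.
Qed.

(** * Standard Borel spaces as Borel retracts of the Baire space *)
Lemma measurable_coordinate_pred k (P : set nat) : measurable [set x : baire | P (x k)].
Proof.
rewrite (_ : [set _ | _] = \bigcup_(i in P) [set x : baire | x k = i]).
  by apply: bigcup_measurable => i _; exact: measurable_coordinate.
by apply/seteqP; split => [x Px|x [i Pi /= ->//]]; exists (x k).
Qed.

Lemma measurable_coordinate2_pred k l (P : nat -> nat -> Prop) :
  measurable [set x : baire | P (x k) (x l)].
Proof.
rewrite (_ : [set _ | _] = \bigcup_i ([set x : baire | x k = i] `&` [set x :
  baire | P i (x l)])).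
  apply: bigcupT_measurable => i; apply: measurableI; first exact: measurable_coordinate.
  exact: measurable_coordinate_pred.
by apply/seteqP; split => [x Px|x [i _ [/= ->]]]; [exists (x k)|].
Qed.

Section baire_retract.
Variables (R : realType) (X : completePseudoMetricType R).
Local Open Scope ring_scope.

Let eps (k : nat) : R := k.+1%:R^-1.
Let eps_gt0 k : 0 < eps k. Proof. by rewrite invr_gt0 ltr0n. Qed.

(** A point is coded by the least indices of points of a countable dense set at
    distance less than [1 / k.+1] from it, and recovered as the limit of these
    approximations.  Balls of a pseudometric need not be open, whence the
    interiors. *)
Lemma polish_baire_retract : polish X ->
  exists (phi : baire -> X) (code : X -> baire), [/\ cancel code phi,
    forall U, open U -> measurable (phi @^-1` U) &
    forall k i, <<s [set U : set X | open U] >> [set x | code x k = i]].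
Proof.
move=> [hX [D cD dD]].
have [q qP] : exists q : nat -> X, forall x e, 0 < e -> exists i, ball x e (q i).
  have /countable_injP[i iinj] := cD.
  exists (fun n => xget point [set x | D x /\ i x = n]) => x e e0.
  have [|y [xy Dy]] := dD (ball x e)^° _ (@open_interior _ _).
    by exists x; apply: nbhsx_ballx.
  exists (i y); case: xgetP => [z _ [Dz iz]|/(_ y)/=]; last by case.
  by rewrite (iinj z y) ?inE//; exact: interior_subset.
have eps_small (e : R) : 0 < e -> exists k, eps k < e.
  by move=> e0; have [k _ /(_ k (leqnn k))] := near_infty_natSinv_lt (PosNum e0); exists k.
pose Z := [set z : baire | forall k l, ball (q (z k)) (eps k + eps l) (q (z l))].
have mZ : measurable Z.
  rewrite (_ : Z = \bigcap_k \bigcap_l [set z : baire |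
    ball (q (z k)) (eps k + eps l) (q (z l))]).
    apply: bigcapT_measurable => k; apply: bigcapT_measurable => l.
    exact: (@measurable_coordinate2_pred k l (fun i j => ball (q i) (eps k + eps l) (q j))).
  by apply/seteqP; split => [z Zz k _ l _|z Zz k l]; [exact: Zz|exact: Zz k I l I].
pose u (z : baire) n := q (z n).
have cvgZ z : Z z -> u z @ \oo --> lim (u z @ \oo).
  move=> Zz; apply: cauchy_cvg; apply: cauchy_exP => e e0.
  have [k ke] := eps_small (e / 2) (divr_gt0 e0 (ltr0Sn _ 1)).
  exists (u z k); exists k => // n /= kn; apply: le_ball (Zz k n).
  rewrite (splitr e) lerD// ltW//; apply: le_lt_trans ke.
  by rewrite lef_pV2 ?posrE ?ltr0n// ler_nat ltnS.
pose phi z := if `[< Z z >] then lim (u z @ \oo) else point.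
have phiZ z : Z z -> phi z = lim (u z @ \oo) by move=> Zz; rewrite /phi asboolT.
have phi_ball z k : Z z -> ball (q (z k)) (2 * eps k) (phi z).
  move=> Zz; rewrite phiZ//.
  have e4 : 0 < eps k / 2 by rewrite divr_gt0.
  have [l le] := eps_small _ e4.
  have [n _ nP] := cvg_ball (cvgZ z Zz) e4.
  have /nP/ball_sym H : (n <= maxn n l)%N by exact: leq_maxl.
  rewrite mulr_natl mulr2n {2}(splitr (eps k)) addrA.
  apply: ball_triangle H; apply: le_ball (Zz k (maxn n l)).
  rewrite lerD2l ltW//; apply: le_lt_trans le.
  by rewrite lef_pV2 ?posrE ?ltr0n// ler_nat ltnS leq_maxr.
have codeP (xk : X * nat) : exists i, (ball (q i) (eps xk.2))^° xk.1 /\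
    forall j, (j < i)%N -> ~ (ball (q j) (eps xk.2))^° xk.1.
  case: xk => x k /=.
  have ex : exists i, `[< (ball (q i) (eps k))^° x >].
    have e2 : 0 < eps k / 2 by rewrite divr_gt0.
    have [i xi] := qP x _ e2; exists i; apply/asboolP.
    apply: filterS (nbhsx_ballx x _ e2) => y xy.
    by rewrite (splitr (eps k)); apply: ball_triangle xy; exact: ball_sym.
  have := ex_minnP ex; case=> m /asboolP xm mmin; exists m; split => // j jm /asboolP /mmin.
  by rewrite leqNgt jm.
have [c cP] := choice codeP.
pose code x : baire := fun k => c (x, k).
have code_ball x k : ball (q (code x k)) (eps k) x.
  by apply: interior_subset; exact: (cP (x, k)).1.
have Zcode x : Z (code x).
  by move=> k l; apply: ball_triangle (code_ball x k) _; exact: ball_sym.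
exists phi, code; split.
- move=> x; rewrite phiZ//; apply: cvg_lim => //.
  apply/cvg_ballP => e e0; have [k ke] := eps_small e e0.
  exists k => // n /= kn; apply: ball_sym; apply: le_ball (code_ball x n).
  rewrite ltW//; apply: le_lt_trans ke.
  by rewrite lef_pV2 ?posrE ?ltr0n// ler_nat ltnS.
- move=> U oU.
  rewrite (_ : phi @^-1` U = (Z `&` \bigcup_k [set z : baire |
    ball (q (z k)) (2 * eps k) `<=` U])
    `|` (if `[< U point >] then ~` Z else set0)).
    apply: measurableU; last by case: ifP => // _; exact: measurableC.
    apply: measurableI => //; apply: bigcupT_measurable => k.
    exact: (@measurable_coordinate_pred k [set i | ball (q i) (2 * eps k) `<=` U]).
  apply/seteqP; split => z /=.
    have [Zz Uz|nZ] := pselect (Z z); last first.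
      by rewrite /phi asboolF// => Up; right; rewrite asboolT.
    left; split => //.
    have /nbhs_ballP[e /= e0 eU] : nbhs (phi z) U by rewrite nbhsE; exists U.
    have [k ke] := eps_small (e / 4) (divr_gt0 e0 (ltr0Sn _ 3)).
    exists k => // y zy; apply: eU.
    apply: (@le_ball _ _ _ (2 * eps k + 2 * eps k)).
      by move: ke; lra.
    by apply: ball_triangle zy; apply: ball_sym; exact: phi_ball.
  case=> [[Zz [k _ kU]]|]; first by apply: kU; exact: phi_ball.
  by case: asboolP => // Up nZ; rewrite /phi asboolF.
- move=> k i.
  pose B j := (ball (q j) (eps k))^°.
  have mB j : <<s [set U : set X | open U] >> (B j).
    by apply: sub_sigma_algebra; exact: open_interior.
  have [s0 sD sU] := smallest_sigma_algebra setT [set U : set X | open U].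
  rewrite (_ : [set _ | _] = ~` (~` B i `|` \bigcup_(j in [set j | j < i]%N) B j)).
    rewrite -setTD; apply: (sD (_ `|` _)).
    rewrite (_ : _ `|` _ = \bigcup_n (if n is n'.+1 then if (n' < i)%N then B n' else
      set0 else ~` B i)).
      by apply: sU => -[|n]; [rewrite -setTD; exact: sD|case: ifP].
    apply/seteqP; split => x; first by case=> [|[j /= ji Bj]]; [exists 0%N|exists j.+1;
      rewrite //= ji].
    by case=> -[|n] _; [left|case: ifP => // ni Bn; right; exists n].
  apply/seteqP; split => x /=.
    move=> <- [|[j ji Bj]]; first by apply; exact: (cP (x, k)).1.
    exact: (cP (x, k)).2 j ji Bj.
  move=> /not_orP[/contrapT Bi Bj].
  have [] := cP (x, k); rewrite -/(code x k) /= => Bc Bl.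
  case: (ltngtP (code x k) i) => // [ci|/Bl//].
  by exfalso; apply: Bj; exists (code x k).
Qed.

End baire_retract.

Lemma standard_borel_retract (R : realType) d (J : measurableType d) :
  standard_borel R J ->
  exists (phi : baire -> J) (code : J -> baire),
   [/\ cancel code phi, measurable_fun setT phi & measurable_fun setT code].
Proof.
move=> [X [f [pX [g fK gK] fB]]].
have [phi [code [codeK mphi mcode]]] := polish_baire_retract pX.
exists (g \o phi), (code \o f); split.
- by move=> x; rewrite /= codeK fK.
- move=> _ B mB; rewrite setTI.
  have : <<s [set U : set X | open U] >> (g @^-1` B).
    by apply/fB; rewrite -comp_preimage (_ : g \o f = id)//; apply/funext.
  rewrite comp_preimage.
  have : <<s [set U : set X | open U] >> `<=` image_set_system setT phi (@measurable _ baire).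
    apply: smallest_sub.
      by apply: sigma_algebra_image; exact: sigma_algebra_measurable.
    by move=> U oU; rewrite /image_set_system /= setTI; exact: mphi.
  by move=> sub /sub; rewrite /image_set_system /= setTI.
- apply: measurable_fun_baire => k i.
  exact: (fB [set x | code x k = i]).1 (mcode k i).
Qed.

(** * Borel graphs of bounded degree *)
Definition dom (T : Type) (F : set (T * T)) : set T := [set x | exists y, F (x, y)].
Definition cod (T : Type) (F : set (T * T)) : set T := [set y | exists x, F (x, y)].

Definition converse (T : Type) (F : set (T * T)) : set (T * T) := swap_pair @^-1` F.

Definition functional_set (T : Type) (F : set (T * T)) :=
  forall x y y', F (x, y) -> F (x, y') -> y = y'.

Definition partial_injection (T : Type) (F : set (T * T)) :=
  functional_set F /\ functional_set (converse F).

Lemma measurable_preimage d1 d2 (T1 : measurableType d1) (T2 : measurableType d2)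
    (f : T1 -> T2) (B : set T2) :
  measurable_fun setT f -> measurable B -> measurable (f @^-1` B).
Proof. by move=> mf mB; rewrite -[X in measurable X]setTI; exact: mf. Qed.

(** Transported from the Baire space.  Only the canonical code of a second
    coordinate is kept, since a point with several codes would break the bound
    on the sections. *)
Lemma standard_borel_uniformization (R : realType) d (J : measurableType d)
    D (E : set (J * J)) : standard_borel R J -> measurable E ->
  (forall x, ~ atleast D.+1 [set y | E (x, y)]) ->
  exists2 h : nat -> J -> J, forall j, measurable_fun setT (h j) &
    forall x y, E (x, y) -> exists j, y = h j x.
Proof.
move=> /standard_borel_retract[phi [code [codeK mphi mcode]]] mE ED.
pose E' : set (baire * baire) := [set p | E (phi p.1, phi p.2) /\
  forall k, code (phi p.2) k = p.2 k].
have [|x [s [us sD sE]]|h mh hE] := @bounded_uniformization D E'.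
- have -> : E' = (fun p : baire * baire => (phi p.1, phi p.2)) @^-1` E `&`
      snd @^-1` \bigcap_k \bigcup_i ([set z : baire | z k = i] `&`
                  (code \o phi) @^-1` [set z : baire | z k = i]).
    apply/seteqP; split => [[x y] [/= Exy cy]|[x y] [/= Exy cy]]; split => //.
      by move=> k _; exists (y k) => //; split => //=; rewrite cy.
    by move=> k; have [i _ [/= <-]] := cy k I.
  apply: measurableI.
    apply: measurable_preimage mE.
    by apply: measurable_fun_pair; apply: measurableT_comp.
  apply: measurable_preimage => //; apply: bigcapT_measurable => k.
  apply: bigcupT_measurable => i; apply: measurableI; first exact: measurable_coordinate.
  apply: measurable_preimage; last exact: measurable_coordinate.
  exact: measurableT_comp.
- apply: (ED (phi x)); exists (map phi s); split; last 2 first.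
  + by rewrite size_map.
  + by move=> _ /mapP[y /sE[/= Exy _] ->].
  rewrite map_inj_in_uniq// => y z /sE[_ /= cy] /sE[_ /= cz] yz.
  by apply/funext => k; rewrite -cy -cz yz.
exists (fun j => phi \o h j \o code).
  by move=> j; apply: measurableT_comp => //; exact: measurableT_comp.
move=> x y Exy; have [|j cj] := hE (code x) (code y); last first.
  by exists j; rewrite /= -cj codeK.
by split; rewrite /= !codeK.
Qed.

(** Measurability of the diagonal: two points agree when all entries of their
    codes do. *)
Lemma measurable_equalizer (R : realType) d (J : measurableType d) (f g : J * J -> J) :
  standard_borel R J -> measurable_fun setT f -> measurable_fun setT g ->
  measurable [set p | f p = g p].
Proof.
move=> /standard_borel_retract[phi [code [codeK mphi mcode]]] mf mg.
rewrite (_ : [set _ | _] = \bigcap_k \bigcup_i ((code \o f) @^-1` [set z : baire | z k = i] `&`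
    (code \o g) @^-1` [set z : baire | z k = i])).
  apply: bigcapT_measurable => k; apply: bigcupT_measurable => i.
  by apply: measurableI; (apply: measurable_preimage;
    [exact: measurableT_comp|exact: measurable_coordinate]).
apply/seteqP; split => p /=.
  by move=> fg k _; exists (code (f p) k) => //; split => //=; rewrite fg.
move=> cfg; apply: (can_inj codeK); apply/funext => k.
by have [i _ [/= -> ->]] := cfg k I.
Qed.

(** An edge (x, y) is found both as [y = h i x] and, by symmetry, as
    [x = h j y]; the edges with given (i, j) form a partial injection. *)
Lemma borel_graph_structure (R : realType) d (J : measurableType d) D (E : set (J * J)) :
  standard_borel R J -> measurable E -> symmetric_rel E ->
  (forall x, ~ atleast D.+1 [set y | E (x, y)]) ->
  (forall F, measurable F -> F `<=` E -> measurable (dom F)) /\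
  exists G : nat -> set (J * J), [/\ forall n, measurable (G n), E = \bigcup_n G n &
    forall n, partial_injection (G n)].
Proof.
move=> sJ mE sE ED.
have [h mh hE] := standard_borel_uniformization sJ mE ED.
split.
  move=> F mF FE.
  rewrite (_ : dom F = \bigcup_j (fun x => (x, h j x)) @^-1` F).
    apply: bigcupT_measurable => j; apply: measurable_preimage mF.
    by apply: measurable_fun_pair => //; exact: mh.
  apply/seteqP; split => x [].
    by move=> y Fxy; have [j yj] := hE x y (FE _ Fxy); exists j; rewrite //= -yj.
  by move=> j _ Fx; exists (h j x).
pose H ij := E `&` ([set p | p.2 = h ij.1 p.1] `&` [set p | p.1 = h ij.2 p.2]).
have mH ij : measurable (H ij).
  apply: measurableI => //; apply: measurableI; apply: (measurable_equalizer sJ) => //.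
    exact: (measurableT_comp (mh _) measurable_fst).
  exact: (measurableT_comp (mh _) measurable_snd).
exists (fun n => if unpickle n is Some ij then H ij else set0); split.
- by move=> n; case: (unpickle n).
- apply/seteqP; split => [[x y] Exy|p [n _]]; last by case: (unpickle n) => // ij [].
  have [i yi] := hE x y Exy; have [j xj] := hE y x (sE _ _ Exy).
  by exists (pickle (i, j)) => //; rewrite pickleK.
- move=> n; case: (unpickle n) => [ij|]; last by split.
  by split => x y y' [_ /= [h1 h2]] [_ /= [h1' h2']]; [rewrite h1 h1'|rewrite h2 h2'].
Qed.

(** * Degrees and mass transport *)
Section counting.
Local Open Scope ring_scope.
Local Open Scope ereal_scope.
Variables (R : realType) (T : choiceType).
Implicit Types A : set T.

Lemma counting_le_atleast A n : counting A <= n%:R%:E :> \bar R -> ~ atleast n.+1 A.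
Proof.
rewrite /counting; case: asboolP => [fA|_]; last by rewrite leye_eq.
rewrite lee_fin ler_nat => An [s [us sn sA]].
suff : (size s <= n)%N by rewrite sn ltnn.
apply: leq_trans An; apply: uniq_leq_size => // y /sA Ay.
by rewrite in_fset_set// inE.
Qed.

Lemma counting_subsingleton A : (forall y y', A y -> A y' -> y = y') ->
  counting A = (`[< A !=set0 >])%:R%:E :> \bar R.
Proof.
move=> A1; case: asboolP => [[y Ay]|nA].
  have -> : A = [set y] by apply/seteqP; split => [z Az|z ->//]; exact: A1.
  by rewrite /counting asboolT// fset_set1 finmap.cardfs1.
have -> : A = set0 by rewrite -subset0 => y Ay; apply: nA; exists y.
by rewrite /counting asboolT// fset_set0 finmap.cardfs0.
Qed.

Lemma counting_le1 A : counting A <= 1 :> \bar R <-> forall y y', A y -> A y' -> y = y'.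
Proof.
split => [/(@counting_le_atleast A 1) A1 y y' Ay Ay'|A1]; last first.
  by rewrite counting_subsingleton// lee_fin; case: asboolP.
apply: contrapT => /eqP yy'; apply: A1; exists [:: y; y']; split => //=.
  by rewrite inE yy'.
by move=> z; rewrite !inE => /orP[] /eqP ->.
Qed.

Lemma counting_gt0 A : 0 < counting A :> \bar R <-> A !=set0.
Proof.
split => [|[y Ay]].
  apply: contraPP => nA; have -> : A = set0 by rewrite -subset0 => y Ay; apply: nA; exists y.
  by rewrite /counting asboolT// fset_set0 finmap.cardfs0 ltxx.
rewrite /counting; case: asboolP => // fA; rewrite lte_fin ltr0n finmap.cardfs_gt0.
by apply/finmap.fset0Pn; exists y; rewrite in_fset_set// inE.
Qed.

End counting.

Section graphing_theory.
Local Open Scope ring_scope.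
Local Open Scope ereal_scope.
Variables (R : realType) (d : measure_display) (J : measurableType d).
Variables (nu : {finite_measure set J -> \bar R}) (E : set (J * J)).
Hypotheses (sJ : standard_borel R J) (gE : graphing nu E).

Let mE : measurable E := graphing_measurable gE.
Let sE : symmetric_rel E := graphing_symmetric gE.

Lemma graphing_structure :
  (forall F, measurable F -> F `<=` E -> measurable (dom F)) /\
  exists G : nat -> set (J * J), [/\ forall n, measurable (G n), E = \bigcup_n G n &
    forall n, partial_injection (G n)].
Proof.
have [D DE] := graphing_bounded_degree gE.
apply: (@borel_graph_structure R _ J D) => // x.
have -> : [set y | E (x, y)] = xsection E x.
  by apply/seteqP; split => y /xsectionP.
exact/(@counting_le_atleast R)/DE.
Qed.

Lemma measurable_dom F : measurable F -> F `<=` E -> measurable (dom F).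
Proof. exact: graphing_structure.1. Qed.

Lemma measurable_swap_pair : measurable_fun setT (@swap_pair J J).
Proof. exact: measurable_fun_pair. Qed.

Lemma measurable_converse (F : set (J * J)) : measurable F -> measurable (converse F).
Proof. by apply: measurable_preimage; exact: measurable_swap_pair. Qed.

Lemma measurable_cod F : measurable F -> F `<=` E -> measurable (cod F).
Proof.
move=> mF FE; apply: (@measurable_dom (converse F)); first exact: measurable_converse.
by move=> [x y] /= /FE /sE.
Qed.

(** Cut into disjoint parts of partial injections, the degree is a countable
    sum of indicator functions. *)
Lemma measurable_fun_deg F : measurable F -> F `<=` E ->
  measurable_fun setT (deg R F).
Proof.
move=> mF FE; have [_ [G [mG GE pG]]] := graphing_structure.
rewrite (_ : deg R F = (fun x => \sum_(n <oo)
   (\1_(dom (F `&` seqDU G n)) x)%:E)).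
  apply: ge0_emeasurable_sum => // k _; apply/measurable_EFinP.
  apply: measurable_indic; apply: measurable_dom; last by move=> p [/FE].
  by apply: measurableI => //; apply: seqDU_measurable.
apply/funext => x; rewrite /deg.
have -> : xsection F x = \bigcup_n xsection (F `&` seqDU G n) x.
  rewrite -xsection_bigcup -setI_bigcupr -seqDU_bigcup_eq -GE.
  by rewrite setIidl.
rewrite measure_semi_bigcup//.
- apply: eq_eseriesr => n _; rewrite /= counting_subsingleton.
    rewrite indicE; congr (_%:R%:E); congr nat_of_bool; apply/asboolP/idP.
      by move=> [y /xsectionP Fy]; apply/mem_set; exists y.
    by move=> /set_mem[y Fy]; exists y; apply/xsectionP.
  move=> y y' /xsectionP[_ Gy] /xsectionP[_ Gy'].
  exact: (pG n).1 (subset_seqDU Gy) (subset_seqDU Gy').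
- move=> n; apply: measurable_xsection; apply: measurableI => //.
  exact: seqDU_measurable.
- apply: trivIset_xsection; apply: trivIset_setIl; exact: trivIset_seqDU.
- apply: bigcupT_measurable => n; apply: measurable_xsection; apply: measurableI => //.
  exact: seqDU_measurable.
Qed.

(** The measure on pairs that counts an edge at its first end.  The two
    measures [arcs] and [converse_arcs] agree on rectangles by hypothesis, hence
    everywhere, rectangles being stable under intersection. *)
Let arcs (F : set (J * J)) : \bar R := \int[nu]_x counting (xsection (F `&` E) x).

Let arcs0 : arcs set0 = 0.
Proof.
rewrite /arcs integral0_eq// => x _.
by rewrite set0I xsection0 measure0.
Qed.

Let arcs_ge0 F : 0 <= arcs F.
Proof. by apply: integral_ge0 => x _; exact: measure_ge0. Qed.

Let arcs_sigma_additive : semi_sigma_additive arcs.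
Proof.
move=> F mF tF mUF.
rewrite [X in _ --> X](_ : _ = \sum_(n <oo) arcs (F n)); last first.
  rewrite -integral_nneseries//=; last first.
    by move=> n; apply: measurable_fun_deg => //; exact: measurableI.
  apply: eq_integral => x _.
  rewrite setI_bigcupl xsection_bigcup measure_semi_bigcup//.
  - by move=> n; apply: measurable_xsection; exact: measurableI.
  - by apply: trivIset_xsection; apply: trivIset_setIr.
  - by apply: bigcupT_measurable => n; apply: measurable_xsection; exact: measurableI.
by apply: is_cvg_nneseries => n _ _; exact: arcs_ge0.
Qed.

HB.instance Definition _ := isMeasure.Build _ _ _ arcs arcs0 arcs_ge0 arcs_sigma_additive.

Let arcs_rectangle A B : measurable A -> measurable B ->
  arcs (A `*` B) = \int[nu]_(x in A) deg_in R E B x.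
Proof.
move=> mA mB; rewrite [RHS]integral_mkcond; apply: eq_integral => x _.
rewrite patchE xsectionI; case: ifPn => xA.
  by rewrite in_xsectionX// setIC.
by rewrite notin_xsectionX// set0I measure0.
Qed.

Let arcsT_lt_pinfty : arcs setT < +oo.
Proof.
have [D DE] := graphing_bounded_degree gE.
rewrite /arcs setTI; apply: (@le_lt_trans _ _ (\int[nu]_x (cst D%:R%:E x))).
  apply: ge0_le_integral => //; first exact: measurable_fun_deg.
  by move=> x _; exact: DE.
rewrite integral_cst//; apply: lte_mul_pinfty => //.
exact: fin_num_fun_lty.
Qed.

Let converse_arcs (F : set (J * J)) : \bar R := arcs (converse F).

Let converse_arcs0 : converse_arcs set0 = 0.
Proof. exact: arcs0. Qed.

Let converse_arcs_ge0 F : 0 <= converse_arcs F.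
Proof. exact: arcs_ge0. Qed.

Let converse_arcs_sigma_additive : semi_sigma_additive converse_arcs.
Proof.
move=> F mF tF mUF; rewrite /converse_arcs /converse preimage_bigcup.
apply: arcs_sigma_additive.
- by move=> n; exact: measurable_converse.
- by move=> i j _ _ [p [Fi Fj]]; apply: tF => //; exists (swap_pair p).
- by rewrite -preimage_bigcup; exact: measurable_converse.
Qed.

HB.instance Definition _ := isMeasure.Build _ _ _ converse_arcs
  converse_arcs0 converse_arcs_ge0 converse_arcs_sigma_additive.

Let arcs_converse F : measurable F -> arcs (converse F) = arcs F.
Proof.
move=> mF; apply/esym.
apply: (@measure_unique _ _ _ [set A `*` B | A in measurable & B in measurable] (fun=> setT)
   _ _ _ _ arcs converse_arcs) => //.
- exact: measurable_prod_measurableType.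
- move=> _ _ [A mA [B mB <-]] [A' mA' [B' mB' <-]].
  exists (A `&` A'); first exact: measurableI.
  exists (B `&` B'); first exact: measurableI.
  by rewrite setXI.
- by move=> _; exists setT => //; exists setT => //; rewrite setXTT.
- by rewrite bigcup_const//; exists 0%N.
- move=> _ [A mA [B mB <-]]; have BA : converse (A `*` B) = B `*` A;
  first by apply/seteqP; split => -[x y] [].
  transitivity (arcs (B `*` A)); last by rewrite -BA.
  by rewrite [LHS]arcs_rectangle// [RHS]arcs_rectangle//; exact: graphing_measure_preserving.
Qed.

Lemma mass_transport F : measurable F -> F `<=` E ->
  \int[nu]_x counting (xsection F x) = \int[nu]_x counting (xsection (converse F) x) :> \bar R.
Proof.
move=> mF FE; have := arcs_converse mF; rewrite /arcs (setIidl FE) => <-.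
by rewrite setIidl// => -[x y] /= /FE /sE.
Qed.

Lemma integral_deg_functional F : measurable F -> F `<=` E -> functional_set F ->
  \int[nu]_x counting (xsection F x) = nu (dom F) :> \bar R.
Proof.
move=> mF FE fF; rewrite -[in RHS](setIT (dom F)) -integral_indic//;
  last exact: measurable_dom.
apply: eq_integral => x _; rewrite counting_subsingleton.
  rewrite indicE; congr (_%:R%:E); congr nat_of_bool; apply/asboolP/idP.
    by move=> [y /xsectionP Fy]; apply/mem_set; exists y.
  by move=> /set_mem[y Fy]; exists y; apply/xsectionP.
by move=> y y' /xsectionP Fy /xsectionP; exact: fF Fy.
Qed.

Lemma measure_dom_cod F : measurable F -> F `<=` E -> partial_injection F ->
  nu (dom F) = nu (cod F).
Proof.
move=> mF FE [fF gF]; rewrite -integral_deg_functional// mass_transport//.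
rewrite integral_deg_functional//; first exact: measurable_converse.
by move=> [x y] /= /FE /sE.
Qed.

End graphing_theory.

(** * The auction *)
Lemma bounded_monotone_stationary (p : nat -> nat) K :
  (forall n, (p n <= p n.+1 <= K)%N) -> exists N, forall n, (N <= n)%N -> p n = p N.
Proof.
move=> pK.
have mono m n : (m <= n)%N -> (p m <= p n)%N.
  elim: n => [|n IH]; first by rewrite leqn0 => /eqP ->.
  by rewrite leq_eqVlt => /orP[/eqP ->//|/IH]; have /andP[+ _] := pK n; lia.
have ex : exists k, `[< exists n, k = K - p n >] by exists (K - p 0); apply/asboolP; exists 0.
have := ex_minnP ex; case=> k /asboolP[N ->] kmin; exists N => n Nn.
have /kmin : `[< exists n', K - p n = K - p n' >] by apply/asboolP; exists n.
by have := mono _ _ Nn; have /andP[] := pK n; have /andP[] := pK N; lia.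
Qed.

Section auction.
Variables (d : measure_display) (J : measurableType d) (H : set (J * J)).
Variables (G : nat -> set (J * J)) (K : nat).
Hypotheses (measurable_domH : forall F, measurable F -> F `<=` H -> measurable (dom F)).
Hypotheses (measurable_codH : forall F, measurable F -> F `<=` H -> measurable (cod F)).
Hypotheses (mG : forall n, measurable (G n)) (HG : H = \bigcup_n G n).
Hypotheses (pG : forall n, partial_injection (G n)).
Hypothesis locally_finite : forall s, exists l : seq J, forall t, H (s, t) -> t \in l.

Let state := (set (J * J) * (J -> nat))%type.

Let bids n (Mp : state) : set (J * J) := G n `&` [set st | ~ dom Mp.1 st.1 /\
  (Mp.2 st.2 < K)%N /\ forall t, H (st.1, t) -> (Mp.2 st.2 <= Mp.2 t)%N].

Let step n (Mp : state) : state :=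
  ((Mp.1 `&` [set st | ~ cod (bids n Mp) st.2]) `|` bids n Mp,
   fun t => (Mp.2 t + `[< cod (bids n Mp) t >])%N).

(** At time [n'] the served partial injection is [G (logn 2 n')]: every index
    occurs at arbitrarily late times. *)
Let run : nat -> state := fix run n :=
  if n is n'.+1 then step (logn 2 n') (run n') else (set0, fun=> 0%N).

Let M n := (run n).1.
Let p n := (run n).2.

Let GH n : G n `<=` H.
Proof. by rewrite HG => x Gx; exists n. Qed.

Let mH : measurable H.
Proof. by rewrite HG; exact: bigcupT_measurable. Qed.

Let M_H n : M n `<=` H.
Proof. by elim: n => [//|n IH] x [[/IH]|[/GH]]. Qed.

Let bidP n s t : bids (logn 2 n) (run n) (s, t) -> [/\ G (logn 2 n) (s, t),
  ~ dom (M n) s, (p n t < K)%N & forall t', H (s, t') -> (p n t <= p n t')%N].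
Proof. by move=> [Gst [/= Ms [pK pmin]]]. Qed.

Let M_functional n : functional_set (M n).
Proof.
elim: n => [//|n IH] s t t' [[Mst _]|bst] [[Mst' _]|bst'].
- exact: IH Mst Mst'.
- by have [_ nM _ _] := bidP bst'; case: nM; exists t.
- by have [_ nM _ _] := bidP bst; case: nM; exists t'.
- by have [Gst _ _ _] := bidP bst; have [Gst' _ _ _] := bidP bst'; exact: (pG _).1 Gst Gst'.
Qed.

Let M_cofunctional n : functional_set (converse (M n)).
Proof.
elim: n => [//|n IH] t s s' [[Mst /= nb]|bst] [[Mst' /= nb']|bst'].
- exact: IH Mst Mst'.
- by case: nb; exists s'.
- by case: nb'; exists s.
- by have [Gst _ _ _] := bidP bst; have [Gst' _ _ _] := bidP bst'; exact: (pG _).2 Gst Gst'.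
Qed.

Let p_mono n t : (p n t <= p n.+1 t)%N.
Proof. by rewrite /p /= leq_addr. Qed.

Let p_le n t : (p n t <= K)%N.
Proof.
elim: n => [//|n IH]; rewrite /p /= -/(p n t); case: asboolP => [[s bst]|_];
  last by rewrite addn0.
by rewrite addn1; have [] := bidP bst.
Qed.

Let p_gt0 n t : (0 < p n t)%N -> cod (M n) t.
Proof.
elim: n => [//|n IH]; rewrite /p /= -/(p n t); case: asboolP => [[s bst] _|nb].
  by exists s; right.
by rewrite addn0 => /IH[s Mst]; exists s; left.
Qed.

(** A bid is made at a cheapest neighbour, just before its price is raised by 1;
    the other prices never decrease. *)
Let p_slack n s t t' : M n (s, t) -> H (s, t') -> (p n t <= (p n t').+1)%N.
Proof.
elim: n => [//|n IH] Mst Hst'.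
suff : (p n.+1 t <= (p n t').+1)%N by move/leq_trans; apply; rewrite ltnS.
rewrite /p /= -/(p n t) -/(p n t').
case: Mst => [[Mst /= nb]|bst]; first by rewrite asboolF// addn0; exact: IH.
by rewrite asboolT ?addn1 ?ltnS; [have [_ _ _] := bidP bst; exact|exists s].
Qed.

Let M_stable n s t : p n.+1 t = p n t -> M n.+1 (s, t) <-> M n (s, t).
Proof.
rewrite /p /= -/(p n t) => pE.
have nb : ~ cod (bids (logn 2 n) (run n)) t.
  by move=> b; move: pE; rewrite asboolT//; lia.
split=> [[[]//|bst]|Mst]; last by left.
by case: nb; exists s.
Qed.

Let stationary t : exists N, forall n, (N <= n)%N -> p n t = p N t.
Proof. by apply: (@bounded_monotone_stationary _ K) => n; rewrite p_mono p_le. Qed.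

Let M_lim := \bigcup_n \bigcap_(m in [set m | n <= m]%N) M m.

Let measurable_fst_preimage (A : set J) : measurable A -> measurable (@fst J J @^-1` A).
Proof. exact: measurable_preimage measurable_fst. Qed.

Let measurable_snd_preimage (A : set J) : measurable A -> measurable (@snd J J @^-1` A).
Proof. exact: measurable_preimage measurable_snd. Qed.

Let measurable_lt (q : J -> nat) : (forall a, measurable [set t | q t = a]) ->
  forall a, measurable [set t | (q t < a)%N].
Proof.
move=> mq a; rewrite (_ : [set _ | _] = \bigcup_(b in [set b | b < a]%N) [set t | q t = b]).
  by apply: bigcup_measurable => b _.
by apply/seteqP; split => [t ta|t [b ba /= ->//]]; exists (q t).
Qed.

Let measurable_bids n (Mp : state) : measurable Mp.1 -> Mp.1 `<=` H ->
  (forall a, measurable [set t | Mp.2 t = a]) -> measurable (bids n Mp).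
Proof.
move: Mp => [N q] /= mN NH mq; apply: measurableI => //.
rewrite (_ : [set _ | _] = fst @^-1` (~` dom N) `&` (snd @^-1` [set t | (q t < K)%N] `&`
  ~` \bigcup_a (fst @^-1` dom (H `&` snd @^-1` [set t | (q t < a)%N]) `&`
                snd @^-1` [set t | q t = a]))).
  apply: measurableI; first by apply: measurable_fst_preimage; apply: measurableC;
    exact: measurable_domH.
  apply: measurableI; first by apply: measurable_snd_preimage; exact: measurable_lt.
  apply: measurableC; apply: bigcupT_measurable => a; apply: measurableI;
    last exact: measurable_snd_preimage.
  apply: measurable_fst_preimage; apply: measurable_domH; last by move=> ? [].
  by apply: measurableI => //; by apply: measurable_snd_preimage; exact: measurable_lt.
apply/seteqP; split => -[s t] /=.
  move=> [Ns [tK tmin]]; do 2 split => //.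
  by move=> [a _ [[t' [Hst' /= t'a]] /= ta]]; have := tmin _ Hst'; lia.
move=> [Ns [tK tmin]]; do 2 split => //.
move=> t' Hst'; rewrite leqNgt; apply/negP => t't; apply: tmin.
by exists (q t) => //; split => //; exists t'.
Qed.

Let measurable_run n : measurable (M n) /\ forall a, measurable [set t | p n t = a].
Proof.
elim: n => [|n [mM mp]].
  split; first exact: measurable0.
  move=> [|a]; first by rewrite (_ : [set _ | _] = setT)//; apply/seteqP; split.
  by rewrite (_ : [set _ | _] = set0)//; apply/seteqP; split.
have mb : measurable (bids (logn 2 n) (run n)) by apply: measurable_bids => //; exact: M_H.
have mcb : measurable (cod (bids (logn 2 n) (run n))).
  by apply: measurable_codH => // st [/GH].
split.
  by apply: measurableU => //; apply: measurableI => //;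
    exact: (measurable_snd_preimage (measurableC mcb)).
move=> a; rewrite (_ : [set _ | _] =
   ([set t | p n t = a] `&` ~` cod (bids (logn 2 n) (run n))) `|`
   ((if a is a'.+1 then [set t | p n t = a'] else set0) `&` cod (bids (logn 2 n) (run n)))).
  apply: measurableU; first by apply: measurableI => //; exact: measurableC.
  by apply: measurableI => //; case: a.
have pS t : p n.+1 t = (p n t + `[< cod (bids (logn 2 n) (run n)) t >])%N by [].
apply/seteqP; split => t /=; rewrite pS.
  case: asboolP => [b|nb]; last by rewrite addn0; left.
  by rewrite addn1 => <-; right.
case=> [[<- nb]|]; first by rewrite asboolF// addn0.
by case: a => [[]//|a /= [<- b]]; rewrite asboolT// addn1.
Qed.

Let stable_M t N n s : (forall m, (N <= m)%N -> p m t = p N t) -> (N <= n)%N ->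
  M n (s, t) <-> M_lim (s, t).
Proof.
move=> pN Nn.
have MN m : (N <= m)%N -> M m (s, t) <-> M N (s, t).
  elim: m => [|m IH]; first by rewrite leqn0 => /eqP ->.
  rewrite leq_eqVlt ltnS => /orP[/eqP ->//|Nm]; rewrite -(IH Nm).
  by apply: M_stable; rewrite !pN// ltnW.
split=> [Mst|[m _ Mst]].
  by exists n => // m /= nm; apply/(MN m (leq_trans Nn nm))/(MN n Nn).
by apply/(MN n Nn)/(MN (maxn N m) (leq_maxl _ _)); apply: Mst; exact: leq_maxr.
Qed.

(** The properties of the limit are read at a time after which the few vertices
    involved are stable.  For the last one, suppose that an unmatched [s] has a
    neighbour cheaper than [K], and let [t0] be a cheapest one.  After all of
    the finitely many neighbours of [s] are stable, the partial injection
    containing (s, t0) is served again, and [s] bids for [t0], whose price moves: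
    a contradiction. *)
Lemma auction_matching : exists (N : set (J * J)) (q : J -> nat),
  [/\ measurable N, N `<=` H & partial_injection N] /\
  [/\ forall a, measurable [set t | (q t < a)%N],
      forall t, (0 < q t)%N -> cod N t,
      forall s t t', N (s, t) -> H (s, t') -> (q t <= (q t').+1)%N &
      forall s t, ~ dom N s -> H (s, t) -> (K <= q t)%N].
Proof.
have [T TP] := choice stationary.
pose q t := p (T t) t.
have qE t n : (T t <= n)%N -> p n t = q t by exact: TP.
have ME t n s : (T t <= n)%N -> M n (s, t) <-> M_lim (s, t) by apply: stable_M; exact: TP.
exists M_lim, q; split; split.
- apply: bigcupT_measurable => n; apply: bigcap_measurableType => m _.
  by have [] := measurable_run m.
- by move=> st [n _ /(_ n (leqnn n)) /M_H].
- split.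
    move=> s t t' [n _ Mn] [n' _ Mn']; apply: (@M_functional (maxn n n') s).
      by apply: Mn; exact: leq_maxl.
    by apply: Mn'; exact: leq_maxr.
  move=> t s s' [n _ Mn] [n' _ Mn']; apply: (@M_cofunctional (maxn n n') t).
    by apply: Mn; exact: leq_maxl.
  by apply: Mn'; exact: leq_maxr.
- apply: measurable_lt => a.
  rewrite (_ : [set _ | _] = \bigcup_n \bigcap_(m in [set m | n <= m]%N) [set t | p m t = a]).
    apply: bigcupT_measurable => n; apply: bigcap_measurableType => m _.
    by have [_] := measurable_run m.
  apply/seteqP; split => t /=; first by move=> qa; exists (T t) => // m /= Tm; rewrite qE.
  move=> [n _ pa]; rewrite -(qE t (maxn n (T t))) ?leq_maxr//; apply: pa; exact: leq_maxl.
- by move=> t /p_gt0[s Mst]; exists s; apply/(ME t (T t)).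
- move=> s t t' Mst Hst'.
  have n1 := leq_maxl (T t) (T t'); have n2 := leq_maxr (T t) (T t').
  rewrite -(qE t _ n1) -(qE t' _ n2); apply: p_slack Hst'.
  by apply/(ME t _ s n1).
- move=> s t nMs Hst; rewrite leqNgt; apply/negP => qK.
  have [l lP] := locally_finite s.
  have [t0 Ht0 t0min] : exists2 t0, H (s, t0) & forall t', H (s, t') -> (q t0 <= q t')%N.
    have ex : exists k, `[< exists2 t', H (s, t') & q t' = k >].
      by exists (q t); apply/asboolP; exists t.
    have := ex_minnP ex; case=> k /asboolP[t0 Ht0 <-] kmin; exists t0 => // t' Ht'.
    by apply: kmin; apply/asboolP; exists t'.
  pose m := \max_(t' <- l) T t'.
  have Tm t' : H (s, t') -> (T t' <= m)%N.
    by move=> /lP t'l; rewrite /m (big_rem _ t'l)/= leq_maxl.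
  have [j _ Gj] : (\bigcup_n G n) (s, t0) by rewrite -HG.
  (* A time after m at which the index j is served. *)
  pose n := (2 ^ j * (m.*2).+1)%N.
  have mn : (m <= n)%N.
    rewrite /n; apply: (@leq_trans m.*2.+1); first by lia.
    by rewrite leq_pmull// expn_gt0.
  have jn : logn 2 n = j.
    rewrite /n lognM ?expn_gt0// pfactorK// lognE /= dvdn2 /= odd_double /=.
    by rewrite addn0.
  have bst : bids (logn 2 n) (run n) (s, t0).
    split; first by rewrite jn.
    split=> /=.
      by move=> [t' Mst']; apply: nMs; exists t'; apply/(ME t' n) => //;
        apply: leq_trans mn; exact/Tm/(@M_H n).
    rewrite -/(p n t0) qE; last by apply: leq_trans mn; exact: Tm.
    split; first by apply: leq_ltn_trans qK; exact: t0min.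
    move=> t' Ht'; rewrite -/(p n t') qE; last by apply: leq_trans mn; exact: Tm.
    exact: t0min.
  have : p n.+1 t0 = p n t0 by rewrite !qE// ?(leqW) //; apply: leq_trans mn; exact: Tm.
  by rewrite /p /= asboolT; [lia|exists s].
Qed.

End auction.

Local Open Scope ring_scope.

(** * The maximal deficiency is attained *)
Lemma small_drop (R : realType) (x : nat -> R) (K : nat) (c : R) :
  (0 < K)%N -> x 0%N - x K <= c -> exists2 i, (i < K)%N & x i - x i.+1 <= c / K%:R.
Proof.
move=> K0 xc; apply: contrapT => nx.
have drop i : (i < K)%N -> c / K%:R < x i - x i.+1.
  by move=> iK; rewrite ltNge; apply/negP => xi; apply: nx; exists i.
have sum i : (i < K)%N -> c / K%:R * i.+1%:R < x 0%N - x i.+1.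
  elim: i => [|i IH] iK; first by rewrite mulr1; exact: drop.
  have := IH (ltnW iK); have := drop _ iK.
  by rewrite -[i.+2]addn1 natrD mulrDr mulr1; lra.
have /sum : (K.-1 < K)%N by lia.
by rewrite prednK// divfK ?pnatr_eq0 -?lt0n//; lra.
Qed.

Section finite_measure_fine.
Variables (R : realType) (d : measure_display) (J : measurableType d).
Variable (nu : {finite_measure set J -> \bar R}).

Definition mass (A : set J) : R := fine (nu A).

Lemma massE A : measurable A -> nu A = (mass A)%:E.
Proof. by move=> mA; rewrite /mass fineK// fin_num_measure. Qed.

Lemma mass_ge0 A : 0 <= mass A. Proof. by apply: fine_ge0. Qed.

Lemma mass_le A B : measurable A -> measurable B -> A `<=` B -> mass A <= mass B.
Proof.
by move=> mA mB AB; rewrite -lee_fin -!massE//; apply: le_measure; rewrite ?inE.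
Qed.

Lemma massU A B : measurable A -> measurable B -> A `&` B = set0 ->
  mass (A `|` B) = mass A + mass B.
Proof.
move=> mA mB AB; apply/EFin_inj; rewrite EFinD -!massE//; last exact: measurableU.
exact: measureU.
Qed.

Lemma massD A B : measurable A -> measurable B -> B `<=` A ->
  mass (A `\` B) = mass A - mass B.
Proof.
move=> mA mB BA; apply/eqP; rewrite eq_sym subr_eq -massU//.
- by rewrite setUC -[in X in mass X](setDUK BA).
- exact: measurableD.
- by rewrite setDE -setIA setICl setI0.
Qed.

Lemma massUI A B : measurable A -> measurable B ->
  mass (A `|` B) + mass (A `&` B) = mass A + mass B.
Proof.
move=> mA mB.
have mAB : measurable (A `&` B) by exact: measurableI.
have -> : A `|` B = A `|` (B `\` (A `&` B)).
  apply/seteqP; split => x [Ax|Bx]; [by left| |by left|by case: Bx; right].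
  by have [Ax|nAx] := pselect (A x); [left|right; split => // -[]].
rewrite massU//; last by rewrite -subset0 => x [Ax [Bx]]; apply.
  by rewrite massD//; lra.
exact: measurableD.
Qed.

Lemma mass_cvg_bigcup (F : nat -> set J) : (forall n, measurable (F n)) ->
  nondecreasing_seq F -> (mass \o F) @ \oo --> mass (\bigcup_n F n).
Proof.
move=> mF ndF; apply: (@fine_cvg _ _ _ _ (nu \o F)); rewrite -massE.
  by apply: nondecreasing_cvg_mu => //; exact: bigcupT_measurable.
exact: bigcupT_measurable.
Qed.

Lemma mass_cvg_bigcap (F : nat -> set J) : (forall n, measurable (F n)) ->
  nonincreasing_seq F -> (mass \o F) @ \oo --> mass (\bigcap_n F n).
Proof.
move=> mF niF; apply: (@fine_cvg _ _ _ _ (nu \o F)); rewrite -massE.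
  apply: nonincreasing_cvg_mu => //; last exact: bigcapT_measurable.
  by rewrite ltey_eq fin_num_measure.
exact: bigcapT_measurable.
Qed.

Section deficiency.
Variables (E : set (J * J)) (S T : set J).
Local Notation N := (neighbourhood E T).
Hypotheses (mS : measurable S).
Hypothesis mN : forall X, measurable X -> X `<=` S -> measurable (N X).

Let N_sub A B : A `<=` B -> N A `<=` N B.
Proof. by move=> AB t [Tt [s As Est]]; split => //; exists s => //; exact: AB. Qed.

Let deficiency X := mass X - mass (N X).

Let admissible X := measurable X /\ X `<=` S.

Let best := sup [set deficiency X | X in admissible].

Let deficiency_le_best X : admissible X -> deficiency X <= best.
Proof.
move=> aX; apply: ub_le_sup; last by exists X.
exists (mass S) => _ [Y [mY YS] <-]; rewrite /deficiency.
by have := mass_ge0 (N Y); have := mass_le mY mS YS; lra.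
Qed.

Let admissibleU A B : admissible A -> admissible B -> admissible (A `|` B).
Proof. by move=> [mA AS] [mB BS]; split; [exact: measurableU|rewrite subUset]. Qed.

(** Supermodularity, the deficiency of the intersection being at most [best]. *)
Let deficiencyU A B : admissible A -> admissible B ->
  deficiency A + deficiency B <= best + deficiency (A `|` B).
Proof.
move=> aA aB; have [mA AS] := aA; have [mB BS] := aB.
have aI : admissible (A `&` B) by split; [exact: measurableI|move=> x [/AS]].
have := deficiency_le_best aI.
have NU : N (A `|` B) = N A `|` N B.
  apply/seteqP; split => [t [Tt [s [As|Bs] Est]]|t [[Tt [s As Est]]|[Tt [s Bs Est]]]].
  - by left; split => //; exists s.
  - by right; split => //; exists s.
  - by split => //; exists s => //; left.
  - by split => //; exists s => //; right.
have : mass (N (A `&` B)) <= mass (N A `&` N B).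
  apply: mass_le; first by case: aI => mI IS; exact: mN.
    by apply: measurableI; exact: mN.
  by move=> t Nt; split; apply: N_sub Nt => s [].
have := massUI mA mB; have := massUI (mN mA AS) (mN mB BS).
by rewrite /deficiency NU; lra.
Qed.

(** Take [X n] within [2^-n] of the supremum.  By [deficiencyU] the defect of
    a finite union of the [X i] with [i >= m] is at most the sum of their
    defects, hence at most [2 * 2^-m]; this bound passes to the increasing
    union [Y m], and then to the intersection [Z] of the decreasing [Y m], where
    only the inclusion of [N Z] in [N (Y m)] is used. *)
Lemma max_deficiency : exists X, [/\ measurable X, X `<=` S &
  forall Y, measurable Y -> Y `<=` S -> mass Y - mass (N Y) <= mass X - mass (N X)].
Proof.
have half_gt0 n : 0 < 2^-1 ^+ n :> R by rewrite exprn_gt0// invr_gt0.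
have hs : has_sup [set deficiency X | X in admissible].
  split; first by exists (deficiency set0); exists set0 => //; split => //; exact: sub0set.
  exists (mass S) => _ [Y [mY YS] <-]; rewrite /deficiency.
  by have := mass_ge0 (N Y); have := mass_le mY mS YS; lra.
have /choice[X XP] : forall n, exists X, admissible X /\ best - 2^-1 ^+ n <= deficiency X.
  by move=> n; have [_ [X aX <-] /ltW dX] := sup_adherent (half_gt0 n) hs; exists X.
pose U m := fix U n := if n is n'.+1 then U n' `|` X (m + n)%N else X m.
have US m n : U m n.+1 = U m n `|` X (m + n.+1)%N by [].
have aU m n : admissible (U m n).
  elim: n => [|n IH]; first exact: (XP m).1.
  by rewrite US; apply: admissibleU => //; exact: (XP _).1.
have dU m n : best - 2 * 2^-1 ^+ m <= deficiency (U m n).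
  (* The partial sum of the geometric series, needed for the induction on n. *)
  suff : best - 2 * 2^-1 ^+ m + 2^-1 ^+ (m + n) <= deficiency (U m n).
    by have := half_gt0 (m + n)%N; lra.
  elim: n => [|n IH]; first by rewrite addn0 /=; have := (XP m).2; lra.
  have := deficiencyU (aU m n) (XP (m + n.+1)%N).1; have := (XP (m + n.+1)%N).2.
  by rewrite -US addnS exprS; lra.
have ndU m : nondecreasing_seq (U m).
  by apply/nondecreasing_seqP => n; rewrite US; apply/subsetPset => x; left.
pose Y m := \bigcup_n U m n.
have aY m : admissible (Y m).
  split; first by apply: bigcupT_measurable => n; exact: (aU m n).1.
  by move=> x [n _]; exact: (aU m n).2.
have niY : nonincreasing_seq Y.
  apply/nonincreasing_seqP => m; apply/subsetPset => x [n _ Ux]; exists n.+1 => //.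
  elim: n Ux => [|n IH]; first by rewrite US addn1; right.
  rewrite US => -[/IH Ux|Xx]; rewrite (US m n.+1); [by left|right].
  by rewrite addnS -addSn.
have dY m : mass (N (Y m)) <= mass (Y m) - best + 2 * 2^-1 ^+ m.
  have NY : N (Y m) = \bigcup_n N (U m n).
    apply/seteqP; split => [t [Tt [s [n _ Us] Est]]|t [n _ [Tt [s Us Est]]]].
      by exists n => //; split => //; exists s.
    by split => //; exists s => //; exists n.
  have cN : (mass \o (fun n => N (U m n))) @ \oo --> mass (N (Y m)).
    rewrite NY; apply: mass_cvg_bigcup; first by move=> n; apply: mN;
      [exact: (aU m n).1|exact: (aU m n).2].
    by move=> n n' /ndU/subsetPset UU; apply/subsetPset/N_sub.
  rewrite -(cvg_lim _ cN)//; apply: limr_le; first by apply/cvg_ex; exists (mass (N (Y m))).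
  near=> n => /=; have := dU m n; have :=
    mass_le (aU m n).1 (aY m).1 (@bigcup_sup _ _ n setT (U m) I).
  by rewrite /deficiency -/(Y m); lra.
pose Z := \bigcap_m Y m.
have aZ : admissible Z.
  split; first by apply: bigcapT_measurable => m; exact: (aY m).1.
  by move=> x /(_ 0%N I); exact: (aY 0%N).2.
have NZ m : mass (N Z) + best <= mass (Y m) + 2 * 2^-1 ^+ m.
  have : mass (N Z) <= mass (N (Y m)).
    apply: mass_le; [exact: mN aZ.1 aZ.2|exact: mN (aY m).1 (aY m).2|].
    by apply: N_sub => x; exact.
  by have := dY m; lra.
have cY : (fun m => mass (Y m) + 2 * 2^-1 ^+ m) @ \oo --> mass Z.
  rewrite -[mass Z]addr0; apply: cvgD.
    by apply: (@mass_cvg_bigcap Y) => // m; exact: (aY m).1.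
  rewrite -[X in _ --> X](mulr0 2); apply: cvgMr; apply: cvg_expr.
  by rewrite ger0_norm ?invr_ge0// invf_lt1 ?ltr1n.
have best_le : best <= deficiency Z.
  suff : mass (N Z) + best <= mass Z by rewrite /deficiency; lra.
  rewrite -(cvg_lim _ cY)//; apply: limr_ge; first by apply/cvg_ex; exists (mass Z).
  by near=> m; exact: NZ.
exists Z; split; [exact: aZ.1|exact: aZ.2|].
by move=> W mW WS; exact: le_trans (deficiency_le_best (conj mW WS)) best_le.
Unshelve. all: by end_near. Qed.

End deficiency.
End finite_measure_fine.

(** * Duality *)
Section konig.
Variables (R : realType) (d : measure_display) (J : measurableType d).
Variables (nu : {finite_measure set J -> \bar R}) (E : set (J * J)) (S T : set J).
Hypotheses (sJ : standard_borel R J) (gE : graphing nu E) (bE : bipartition E S T).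

Local Notation mass := (mass nu).
Local Notation N := (neighbourhood E T).

Let mE : measurable E := graphing_measurable gE.
Let sE : symmetric_rel E := graphing_symmetric gE.
Let mS : measurable S := bipartition_measurableS bE.
Let mT : measurable T := bipartition_measurableT bE.
Let mdom F : measurable F -> F `<=` E -> measurable (dom F) :=
  @measurable_dom _ _ _ _ _ sJ gE F.
Let mcod F : measurable F -> F `<=` E -> measurable (cod F) :=
  @measurable_cod _ _ _ _ _ sJ gE F.

Let ST_disjoint x : S x -> T x -> False.
Proof. by move=> Sx Tx; rewrite -[False]/(set0 x) -(bipartition_disjoint bE). Qed.

Let edge_ST x y : E (x, y) -> S x -> T y.
Proof. by move=> /(bipartition_edge bE)[[]//|[Tx _] /ST_disjoint]; case. Qed.

Let edge_TS x y : E (x, y) -> T x -> S y.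
Proof. by move=> /(bipartition_edge bE)[[Sx _] Tx|[]//]; case: (ST_disjoint Sx Tx). Qed.

Let boundaryE (A : set J) (Z : set (J * J)) : boundary R A Z = A `&` dom Z.
Proof.
apply/seteqP; split => [x [Ax /counting_gt0[y /xsectionP Zy]]|x [Ax [y Zy]]].
  by split => //; exists y.
by split => //; apply/counting_gt0; exists y; apply/xsectionP.
Qed.

Let measurable_boundary (A : set J) (Z : set (J * J)) : measurable A ->
  borel_edge_sets E Z -> measurable (boundary R A Z).
Proof. by move=> mA [ZE sZ mZ]; rewrite boundaryE; apply: measurableI => //; exact: mdom. Qed.

Lemma measurable_neighbourhood X : measurable X -> X `<=` S -> measurable (N X).
Proof.
move=> mX XS; rewrite (_ : N X = T `&` cod (E `&` fst @^-1` X)).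
  apply: measurableI => //; apply: mcod; last by move=> ? [].
  by apply: measurableI => //; exact: measurable_preimage measurable_fst mX.
apply/seteqP; split => [t [Tt [s Xs Est]]|t [Tt [s [Est Xs]]]].
  by split => //; exists s.
by split => //; exists s.
Qed.

Let mass_dom_cod F : measurable F -> F `<=` E -> partial_injection F ->
  mass (dom F) = mass (cod F).
Proof. by move=> mF FE pF; rewrite /mass (measure_dom_cod sJ gE). Qed.

Let borel_edge_setsD Z : borel_edge_sets E Z -> borel_edge_sets E (E `\` Z).
Proof.
move=> [ZE sZ mZ]; split; [by move=> x []| |exact: measurableD].
by move=> x y [Exy nZ]; split; [exact: sE|move=> /sZ].
Qed.

(** Each edge is counted at both of its ends, one in S and one in T, and the two
    sets of ends have the same measure: this cancels the factor 1/2. *)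
Let edge_measure_functional F : borel_edge_sets E F -> functional_set F ->
  edge_measure nu F = (mass (dom (F `&` S `*` T)))%:E.
Proof.
move=> [FE sF mF] fF; pose M := F `&` S `*` T.
have mM : measurable M by apply: measurableI => //; exact: measurableX.
have ME : M `<=` E by move=> p [/FE].
have pM : partial_injection M.
  split; first by move=> x y y' [Fy _] [Fy' _]; exact: fF Fy Fy'.
  by move=> x y y' [/= /sF Fy _] [/= /sF Fy' _]; exact: fF Fy Fy'.
rewrite /edge_measure (integral_deg_functional sJ gE)//.
rewrite massE; last exact: mdom.
have -> : dom F = dom M `|` cod M.
  apply/seteqP; split => [x [y Fxy]|x [[y [Fxy _]]|[y [Fyx _]]]].
  - have [[Sx Ty]|[Tx Sy]] := bipartition_edge bE (FE _ Fxy).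
      by left; exists y.
    by right; exists y; split => //; exact: sF.
  - by exists y.
  - by exists y; exact: sF.
rewrite massU; [|exact: mdom|exact: mcod|]; last first.
  by rewrite -subset0 => x [[y [_ [/= Sx _]]] [z [_ [/= _ Tx]]]]; exact: ST_disjoint Sx Tx.
by rewrite -mass_dom_cod// -EFinM; congr (_%:E); lra.
Qed.

Let matching_functional F : measurable_matchings R E F -> functional_set F.
Proof.
by move=> [_ F1] x y y' Fy Fy'; apply: (counting_le1 R _).1 (F1 x) _ _ _ _; exact/xsectionP.
Qed.

(** The edges of the matching in [Z] are counted in S and the others in T, by
    the equality of the measures of the two sides of a partial injection. *)
Lemma weak_duality F Z : measurable_matchings R E F -> borel_edge_sets E Z ->
  (edge_measure nu F <= nu (boundary R S Z) + nu (boundary R T (E `\` Z)))%E.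
Proof.
move=> mtF bZ; have fF := matching_functional mtF; have [bF _] := mtF.
have [FE sF mF] := bF; have [ZE sZ mZ] := bZ; have bZ' := borel_edge_setsD bZ.
rewrite edge_measure_functional// !massE; try exact: measurable_boundary.
pose M Z' := (F `&` S `*` T) `&` Z'.
have mM Z' : measurable Z' -> measurable (M Z').
  by move=> mZ'; apply: measurableI => //; apply: measurableI => //; exact: measurableX.
have ME Z' : M Z' `<=` E by move=> p [[/FE]].
have mCZ : measurable (~` Z) by exact: measurableC.
apply: (@le_trans _ _ (mass (dom (M Z)) + mass (dom (M (~` Z))))%:E); last first.
  rewrite -EFinD lee_fin lerD//.
    apply: mass_le; [by apply: mdom => //; exact: mM|exact: measurable_boundary|].
    by rewrite boundaryE => x [y [[_ [Sx _]] Zy]]; split => //; exists y.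
  rewrite mass_dom_cod//; last 2 first.
  - exact: mM.
  - split; first by move=> x y y' [[Fy _] _] [[Fy' _] _]; exact: fF Fy Fy'.
    by move=> x y y' [[/= /sF Fy _] _] [[/= /sF Fy' _] _]; exact: fF Fy Fy'.
  apply: mass_le; [by apply: mcod => //; exact: mM|exact: measurable_boundary|].
  rewrite boundaryE => y [x [[Fxy [_ Ty]] nZ]]; split => //; exists x.
  by split; [exact/sE/FE|move=> /sZ].
rewrite lee_fin; have mdM Z' : measurable Z' -> measurable (dom (M Z')) by move=> ?;
  apply: mdom => //; exact: mM.
have -> : dom (F `&` S `*` T) = dom (M Z) `|` dom (M (~` Z)).
  apply/seteqP; split => [x [y Fxy]|x [[y []]|[y []]]]; [|by exists y|by exists y].
  by have [Zxy|nZxy] := pselect (Z (x, y)); [left|right]; exists y.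
have := massUI nu (mdM Z mZ) (mdM _ mCZ).
by have := mass_ge0 nu (dom (M Z) `&` dom (M (~` Z))); lra.
Qed.

Lemma edge_cover_of_set X : measurable X -> X `<=` S -> exists2 Z, borel_edge_sets E Z &
  (nu (boundary R S Z) + nu (boundary R T (E `\` Z)) <=
   (mass S - (mass X - mass (N X)))%:E)%E.
Proof.
move=> mX XS; pose A := S `\` X.
have mA : measurable A by exact: measurableD.
pose Z := E `&` (fst @^-1` A `|` snd @^-1` A).
have bZ : borel_edge_sets E Z.
  split; first by move=> ? [].
    by move=> x y [Exy [Ax|Ay]]; split; [exact: sE|right|exact: sE|left].
  apply: measurableI => //; apply: measurableU.
    exact: measurable_preimage measurable_fst mA.
  exact: measurable_preimage measurable_snd mA.
exists Z => //; have bZ' := borel_edge_setsD bZ.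
rewrite !massE; try exact: measurable_boundary.
rewrite -EFinD lee_fin.
have : mass (boundary R S Z) <= mass A.
  apply: mass_le; [exact: measurable_boundary|exact: mA|].
  rewrite boundaryE => x [Sx [y [Exy [//|[Sy _]]]]].
  by case: (ST_disjoint Sy (edge_ST Exy Sx)).
have : mass (boundary R T (E `\` Z)) <= mass (N X).
  apply: mass_le; [exact: measurable_boundary|exact: measurable_neighbourhood|].
  rewrite boundaryE => t [Tt [s [Ets nZ]]]; split => //; exists s; last exact: sE.
  apply: contrapT => nXs; apply: nZ; split => //; right; split => //.
  exact: edge_TS Ets Tt.
by rewrite (massD _ mS mX XS); lra.
Qed.

(** The auction with price cap [K].  [X i] is the set of the vertices of S all of
    whose neighbours cost at least [i]. *)
Lemma near_optimal_matching K : (0 < K)%N -> exists F X,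
  [/\ measurable_matchings R E F, measurable X /\ X `<=` S &
   ((mass S - (mass X - mass (N X)) - mass S / K%:R)%:E <= edge_measure nu F)%E].
Proof.
move=> K0; pose H := E `&` S `*` T.
have [_ [G [mG GE pG]]] := graphing_structure sJ gE.
have HE : H `<=` E by move=> ? [].
have mH : measurable H by apply: measurableI => //; exact: measurableX.
have [||||||M [p [[mM MH pM] [mp p_gt0 p_slack p_K]]]] :=
   @auction_matching _ _ H (fun n => G n `&` S `*` T) K.
- by move=> F mF FH; apply: mdom => // x /FH/HE.
- by move=> F mF FH; apply: mcod => // x /FH/HE.
- by move=> n; apply: measurableI => //; exact: measurableX.
- by rewrite -setI_bigcupl -GE.
- move=> n; have [f g] := pG n.
  by split => [x y y' [Gy _] [Gy' _]|x y y' [/= Gy _] [/= Gy' _]];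
    [exact: f Gy Gy'|exact: g Gy Gy'].
- move=> s; have [D DE] := graphing_bounded_degree gE.
  have : finite_set (xsection E s).
    by move: (DE s); rewrite /deg /counting; case: asboolP => //; rewrite leye_eq.
  move=> /finite_seqP[l lE]; exists l => t [Est _].
  by have : xsection E s t by [exact/xsectionP]; rewrite lE.
have ME : M `<=` E by move=> x /MH/HE.
pose U0 := S `\` dom M.
have dMS : dom M `<=` S by move=> x [y /MH[_ []]].
have mU0 : measurable U0 by apply: measurableD => //; exact: mdom.
pose X i := S `\` dom (H `&` snd @^-1` [set t | (p t < i)%N]).
have mX i : measurable (X i).
  apply: measurableD => //; apply: mdom; last by move=> x [/HE].
  by apply: measurableI => //; exact: measurable_preimage measurable_snd (mp i).
have XP i s t : X i s -> H (s, t) -> (i <= p t)%N.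
  by move=> [_ nd] Hst; rewrite leqNgt; apply/negP => ti; apply: nd; exists t.
have XS i : X i `<=` S by move=> s [].
(* The holders of N (X i.+1) cost more than i, so by the slack of 1 all their
   neighbours cost at least i. *)
have level i : (i < K)%N -> mass (N (X i.+1)) + mass U0 <= mass (X i).
  move=> iK; pose Mi := M `&` snd @^-1` N (X i.+1).
  have mMi : measurable Mi.
    apply: measurableI => //; apply: measurable_preimage => //;
      exact: measurable_neighbourhood.
  have MiE : Mi `<=` E by move=> x [/ME].
  have NP t : N (X i.+1) t -> (i < p t)%N.
    move=> [Tt [s Xs Est]]; apply: (XP _ _ _ Xs); split => //; split => //=; exact: XS Xs.
  have -> : N (X i.+1) = cod Mi.
    apply/seteqP; split => [t Nt|t [s [_]]//].
    have [s Mst] := p_gt0 t (leq_ltn_trans (leq0n _) (NP t Nt)).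
    by exists s.
  rewrite -mass_dom_cod//; last first.
    have [f g] := pM.
    by split => [x y y' [My _] [My' _]|x y y' [/= My _] [/= My' _]];
      [exact: f My My'|exact: g My My'].
  have mdMi : measurable (dom Mi) by exact: mdom.
  rewrite -massU//; last first.
    by rewrite -subset0 => s [[t [Mst _]] [_ nd]]; apply: nd; exists t.
  apply: mass_le => //; first exact: measurableU.
  move=> s [[t [Mst /NP it]]|[Ss nd]].
    split; first by apply: dMS; exists t.
    move=> [t' [Hst' /= t'i]]; have := p_slack _ _ _ Mst Hst'; move: it => /=; lia.
  split => // -[t' [Hst' /= t'i]]; have := p_K _ _ nd Hst'; lia.
have [i iK drop] : exists2 i, (i < K)%N & mass (X i) - mass (X i.+1) <= mass S / K%:R.
  apply: small_drop => //.
  by have := mass_ge0 nu (X K); have := mass_le nu (mX 0%N) mS (XS 0%N); lra.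
pose F := M `|` converse M.
have bF : borel_edge_sets E F.
  split; first by move=> [x y] [/ME//|/ME /sE].
    by move=> x y [Mxy|Myx]; [right|left].
  by apply: measurableU => //; exact: measurable_converse.
have fF : functional_set F.
  have [f g] := pM.
  move=> x y y' [My|My] [My'|My'].
  - exact: f My My'.
  - have [_ [/= Sx _]] := MH _ My; have [_ [/= _ Tx]] := MH _ My'.
    by case: (ST_disjoint Sx Tx).
  - have [_ [/= Sx _]] := MH _ My'; have [_ [/= _ Tx]] := MH _ My.
    by case: (ST_disjoint Sx Tx).
  - exact: g My My'.
exists F, (X i.+1); split; [split => //|by split|].
  by move=> x; apply/counting_le1 => y y' /xsectionP Fy /xsectionP Fy'; exact: fF Fy Fy'.
rewrite edge_measure_functional// lee_fin.
have -> : F `&` S `*` T = M.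
  apply/seteqP; split => [[x y] [[//|/MH[_ [/= _ Tx]]] [/= Sx _]]|[x y] Mxy].
    by case: (ST_disjoint Sx Tx).
  by have [_ STxy] := MH _ Mxy; split => //; left.
have := level i iK; rewrite /U0 massD//; last exact: mdom.
by move: drop; lra.
Qed.

End konig.

Local Open Scope ereal_scope.

Theorem theorem7p2 (R : realType) (d : measure_display) (J : measurableType d)
    (nu : {finite_measure set J -> \bar R}) (E : set (J * J)) (S T : set J)
    (nu_standard : standard_measure_space nu)
    (E_graphing : graphing nu E)
    (ST_bipartition : bipartition E S T) :
  let matching_sup :=
    ereal_sup [set edge_measure nu M | M in measurable_matchings R E] in
  is_min [set nu (boundary R S Z) + nu (boundary R T (E `\` Z))
         | Z in borel_edge_sets E] matching_sup
  /\ (exists2 k : \bar R,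
        is_max [set nu X - nu (neighbourhood E T X)
               | X in [set X : set J | d.-measurable X /\ X `<=` S]] k
        & matching_sup = nu S - k).
Proof.
move=> matching_sup; have [sJ _] := nu_standard.
have mS := bipartition_measurableS ST_bipartition.
have mN := measurable_neighbourhood sJ E_graphing ST_bipartition.
have [X [mX XS Xmax]] := max_deficiency nu mS mN.
have [Z bZ Zle] := edge_cover_of_set sJ E_graphing ST_bipartition mX XS.
set a := (_ - _)%R in Zle.
have sup_le Z' : borel_edge_sets E Z' ->
    matching_sup <= nu (boundary R S Z') + nu (boundary R T (E `\` Z')).
  move=> bZ'; apply: ge_ereal_sup => _ [F mF <-].
  exact: (weak_duality sJ E_graphing ST_bipartition).
have le_sup : a%:E <= matching_sup.
  apply/lee_addgt0Pr => e e0.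
  have [K K0 Ke] : exists2 K, (0 < K)%N & (mass nu S / K%:R < e)%R.
    have := truncnS_gt (mass nu S / e); set K := (Num.truncn _).+1 => KS.
    exists K => //; rewrite ltr_pdivrMr ?ltr0n// mulrC -ltr_pdivrMr//.
  have [F [Y [mF [mY YS] Fle]]] := near_optimal_matching sJ E_graphing ST_bipartition K0.
  rewrite -leeBlDr//; apply: (@le_trans _ _ (edge_measure nu F)); last first.
    by apply: ereal_sup_ubound; exists F.
  apply: le_trans Fle; rewrite -EFinB lee_fin.
  by have := Xmax Y mY YS; rewrite /a; lra.
have supE : matching_sup = a%:E.
  by apply/eqP; rewrite eq_le le_sup andbT; apply: le_trans Zle; exact: sup_le.
have defE Y : d.-measurable Y -> Y `<=` S ->
    nu Y - nu (neighbourhood E T Y) = (mass nu Y - mass nu (neighbourhood E T Y))%:E.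
  by move=> mY YS; rewrite !massE//; exact: mN.
split.
  split; last by move=> _ [Z' bZ' <-]; exact: sup_le.
  by exists Z => //; apply/eqP; rewrite eq_le supE Zle -supE sup_le.
exists (nu X - nu (neighbourhood E T X)).
  split; first by exists X.
  by move=> _ [Y [mY YS] <-]; rewrite !defE// lee_fin; exact: Xmax.
by rewrite supE defE// massE.
Qed.
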